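(* Let $T$ be a complete local ring and let $\Pi$ denote the prime subring of $T$. For each $i \in \mathbb{N}$, let $C_i$ be a nonempty countable set of nonmaximal pairwise incomparable prime ideals of $T$, and suppose that, if $i \neq j$, then either $C_i = C_j$ or no element of $C_i$ is contained in an element of $C_j$. Then there exists a local domain $A \subseteq T$ with $\widehat{A} \cong T$ such that, for all $i \in \mathbb{N}$, there is a nonzero prime element $p_i$ of $A$ such that $C_i$ is exactly the set of maximal elements of the formal fiber of $A$ at $p_iA$, if and only if there exists a set of nonzero elements $\mathfrak{q} = \{q_i\}_{i=1}^{\infty}$ of $T$ satisfying the following conditions: (i) For $i \in \mathbb{N}$ we have $q_i \in \bigcap_{Q \in C_i} Q$ and, if $C_j \neq C_i$ and $Q' \in C_j$, then $q_i \notin Q'$; (ii) $P \cap \Pi[\mathfrak{q}] = (0)$ for all $P \in \mathrm{Ass}(T)$; (iii) If $i \in \mathbb{N}$ and $P' \in \mathrm{Ass}(T/q_iT)$, then $P' \subseteq Q$ for some $Q \in C_i$; and (iv) If $i \in \mathbb{N}$ and $Q \in C_i$, then $F_{\Pi[\mathfrak{q}]} \cap Q \subseteq q_iT$, where $F_{\Pi[\mathfrak{q}]}$ is the quotient field of $\Pi[\mathfrak{q}]$.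
   Context: Rings are commutative with identity; $\mathbb{N}$ is the set of positive integers. A local ring is a Noetherian ring with a unique maximal ideal; a complete local ring is one complete with respect to its maximal ideal; $\widehat{A}$ is the completion of a local ring $A$ at its maximal ideal. For a local subring $A \subseteq T$, $\widehat{A} \cong T$ means that the natural homomorphism $\widehat{A} \to T$ induced by the inclusion is an isomorphism. The formal fiber of $A$ at a prime ideal $P$ of $A$ is identified with $\{Q \in \mathrm{Spec}(T) \mid Q \cap A = P\}$; maximal elements are with respect to inclusion. Countable means finite or countably infinite. Pairwise incomparable means that no element of the set is contained in a different element of the set. The prime subring $\Pi$ is the image of $\mathbb{Z}$ in $T$, and $\Pi[\mathfrak{q}]$ is the subring of $T$ generated by $\Pi$ and all $q_i$. $\mathrm{Ass}(T/q_iT)$ is the set of associated primes of the $T$-module $T/q_iT$ (primes of $T$). If $R \subseteq T$ is a subring that is a domain whose nonzero elements are regular in $T$ (for $R=\Pi[\mathfrak{q}]$ this follows from (ii)), $F_R$ is its quotient field, and $F_R \cap Q$ is taken in the total quotient ring of $T$; that is, $F_R \cap Q = \{x \in Q \mid sx = r \text{ for some } r,s \in R,\ s \neq 0\}$. *)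

(* Defs.v *)
From HB Require Import structures.
From mathcomp Require Import all_boot all_algebra.
From mathcomp Require Import boolp classical_sets functions cardinality.

Set Implicit Arguments.
Unset Strict Implicit.
Unset Printing Implicit Defensive.

Import GRing.Theory.
Local Open Scope classical_set_scope.
Local Open Scope ring_scope.
Local Open Scope quotient_scope.

Section Ideals.
Variable R : comNzRingType.
Implicit Types (I J M P S : set R) (x y a : R).

(* Unlike the library's [idealr_closed], the unit ideal is allowed. *)
Definition is_ideal I : Prop :=
  [/\ I 0, (forall x y, I x -> I y -> I (x + y)) & (forall a x, I x -> I (a * x))].

Definition prime_ideal P : Prop :=
  [/\ is_ideal P, ~ P 1 & forall x y, P (x * y) -> P x \/ P y].

Definition maximal_ideal M : Prop :=
  [/\ is_ideal M, ~ M 1 & forall J, is_ideal J -> M `<=` J -> J = M \/ J 1].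

Definition ideal_gen S : set R :=
  [set x | forall J, is_ideal J -> S `<=` J -> J x].

Definition principal a : set R := [set x | exists y, x = a * y].

Fixpoint ideal_exp I (n : nat) : set R :=
  if n is n'.+1 then ideal_gen [set z | exists x y, [/\ I x, ideal_exp I n' y & z = x * y]]
  else setT.

(* [Ass I] is Ass(R/I): the primes that are annihilators of an element of R/I,
   where [x] is a representative of that element. *)
Definition Ass I : set (set R) :=
  [set P | prime_ideal P /\ exists x, P = [set t | I (t * x)]].

Definition prime_element a : Prop :=
  [/\ a <> 0, ~ principal a 1 &
      forall x y, principal a (x * y) -> principal a x \/ principal a y].

Lemma ideal_gen_ideal S : is_ideal (ideal_gen S).
Proof.
split=> [J [] //|x y Ix Iy J JI SJ|a x Ix J JI SJ]; case: (JI) => _ JD JM.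
  by apply: JD; [exact: Ix|exact: Iy].
by apply: JM; exact: Ix.
Qed.

Lemma ideal_exp_ideal I n : is_ideal (ideal_exp I n).
Proof. by case: n => [|n] //=; exact: ideal_gen_ideal. Qed.

Lemma ideal_expB I n x y :
  ideal_exp I n x -> ideal_exp I n y -> ideal_exp I n (x - y).
Proof.
have [_ hD hM] := ideal_exp_ideal I n => hx hy.
by apply: hD => //; rewrite -mulN1r; exact: hM.
Qed.

End Ideals.

Definition noetherian (R : comNzRingType) : Prop :=
  forall I : set R, is_ideal I -> exists s : seq R, I = ideal_gen [set` s].

Definition local_ring (R : comNzRingType) : Prop :=
  noetherian R /\ exists! M : set R, maximal_ideal M.

(* The [I]-adic completion, i.e. the inverse limit of the R/I^n, realized as the
   ring of sequences [a] with a_{n+1} = a_n mod I^n for all n, modulo the ideal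
   of those with a_n = 0 mod I^n for all n. *)
Section Completion.
Variables (R : comNzRingType) (I : set R).

Definition coherent : {pred nat -> R} :=
  fun a => `[< forall n, ideal_exp I n (a n.+1 - a n) >].

Lemma coherent_subring : subring_closed coherent.
Proof.
split.
- by apply/asboolP => n; rewrite subrr; case: (ideal_exp_ideal I n).
- move=> a b /asboolP ha /asboolP hb; apply/asboolP => n.
  rewrite [X in ideal_exp _ _ X](_ : _ = (a n.+1 - a n) - (b n.+1 - b n)).
    exact: ideal_expB.
  change ((a n.+1 - b n.+1) - (a n - b n) = (a n.+1 - a n) - (b n.+1 - b n)).
  by rewrite !opprD !opprK addrACA.
- move=> a b /asboolP ha /asboolP hb; apply/asboolP => n.
  have [_ hD hM] := ideal_exp_ideal I n.
  rewrite [X in ideal_exp _ _ X]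
    (_ : _ = b n.+1 * (a n.+1 - a n) + a n * (b n.+1 - b n)).
    by apply: hD; exact: hM.
  change (a n.+1 * b n.+1 - a n * b n =
          b n.+1 * (a n.+1 - a n) + a n * (b n.+1 - b n)).
  by rewrite !mulrBr [b n.+1 * a n]mulrC addrA subrK mulrC.
Qed.

HB.instance Definition _ :=
  GRing.isSubringClosed.Build (nat -> R) coherent coherent_subring.

Definition coherent_ring : Type := {a : nat -> R | a \in coherent}.
HB.instance Definition _ := SubType.on coherent_ring.
HB.instance Definition _ := Choice.on coherent_ring.
HB.instance Definition _ := [SubChoice_isSubComNzRing of coherent_ring by <:].

Definition null_coherent : {pred coherent_ring} :=
  fun a => `[< forall n, ideal_exp I n (val a n) >].

Lemma null_coherent_zmod : zmod_closed null_coherent.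
Proof.
split; first by apply/asboolP => n; case: (ideal_exp_ideal I n).
move=> a b /asboolP ha /asboolP hb; apply/asboolP => n.
exact: ideal_expB.
Qed.

HB.instance Definition _ :=
  GRing.isZmodClosed.Build coherent_ring null_coherent null_coherent_zmod.

Lemma null_coherentM (a b : coherent_ring) :
  b \in null_coherent -> a * b \in null_coherent.
Proof.
move=> /asboolP hb; apply/asboolP => n.
by have [_ _ hM] := ideal_exp_ideal I n; exact: hM.
Qed.

Definition completion : Type := Quotient.quot null_coherent.
HB.instance Definition _ := GRing.Zmodule.on completion.
HB.instance Definition _ := EqQuotient.on completion.

Definition completion_one : completion := \pi_completion 1.
Definition completion_mul (x y : completion) : completion :=
  \pi_completion (repr x * repr y).

Lemma completion_eqP (a b : coherent_ring) :
  reflect (\pi_completion a = \pi_completion b) (a - b \in null_coherent).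
Proof. by rewrite Quotient.idealrBE; exact: eqP. Qed.

Lemma completion_mulE (a b : coherent_ring) :
  completion_mul (\pi_completion a) (\pi_completion b) = \pi_completion (a * b).
Proof.
apply/completion_eqP; set a' := repr _; set b' := repr _.
have ha : a' - a \in null_coherent by apply/completion_eqP; rewrite reprK.
have hb : b' - b \in null_coherent by apply/completion_eqP; rewrite reprK.
have -> : a' * b' - a * b = b' * (a' - a) + a * (b' - b).
  by rewrite !mulrBr [b' * a]mulrC addrA subrK mulrC.
by rewrite rpredD ?null_coherentM.
Qed.

Fact completion_mulA : associative completion_mul.
Proof.
move=> x y z; rewrite -[x]reprK -[y]reprK -[z]reprK.
move: (repr x) (repr y) (repr z) => a b c.
by rewrite (completion_mulE b c) (completion_mulE a b) !completion_mulE mulrA.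
Qed.

Fact completion_mulC : commutative completion_mul.
Proof.
move=> x y; rewrite -[x]reprK -[y]reprK; move: (repr x) (repr y) => a b.
by rewrite !completion_mulE mulrC.
Qed.

Fact completion_mul1 : left_id completion_one completion_mul.
Proof.
by move=> x; rewrite -[x]reprK /completion_one; move: (repr x) => a;
   rewrite completion_mulE mul1r.
Qed.

Fact completion_mulD : left_distributive completion_mul +%R.
Proof.
move=> x y z.
have piD (a b : coherent_ring) :
    \pi_completion (a + b) = \pi_completion a + \pi_completion b.
  exact: (raddfD (\pi_completion : coherent_ring -> Quotient.quot null_coherent)).
rewrite -[x]reprK -[y]reprK -[z]reprK; move: (repr x) (repr y) (repr z) => a b c.
by rewrite -piD (completion_mulE a c) (completion_mulE b c) completion_mulE mulrDl piD.
Qed.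

HB.instance Definition _ := GRing.Zmodule_isComPzRing.Build completion
  completion_mulA completion_mulC completion_mul1 completion_mulD.

Lemma coherent_cst (x : R) : (fun=> x) \in coherent.
Proof. by apply/asboolP => n; rewrite subrr; case: (ideal_exp_ideal I n). Qed.

Definition to_completion (x : R) : completion :=
  \pi_completion (exist _ (fun=> x) (coherent_cst x)).

End Completion.

Definition complete_local_ring (T : comNzRingType) : Prop :=
  local_ring T /\
  forall M : set T, maximal_ideal M -> bijective (@to_completion T M).

Section Subrings.
Variable T : comNzRingType.

Definition subring_of (A : subringClosed T) : Type := {x : T | x \in A}.
HB.instance Definition _ (A : subringClosed T) := SubType.on (subring_of A).
HB.instance Definition _ (A : subringClosed T) := Choice.on (subring_of A).
HB.instance Definition _ (A : subringClosed T) :=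
  [SubChoice_isSubComNzRing of subring_of A by <:].

Definition local_domain (A : subringClosed T) : Prop :=
  local_ring (subring_of A) /\ GRing.integral_domain_axiom (subring_of A).

(* [phi] is the natural map induced by the inclusion: it sends the class of a
   coherent sequence [a] of elements of A to the limit of [a] in T. When T is
   complete there is at most one such map, and for one to exist the maximal
   ideal of A must lie in that of T. *)
Definition completion_iso (A : subringClosed T) : Prop :=
  forall (m : set (subring_of A)) (M : set T),
    maximal_ideal m -> maximal_ideal M ->
    exists phi : {rmorphism completion m -> T},
      (forall (a : coherent_ring m) (n : nat),
         ideal_exp M n (phi (\pi_(completion m) a) - val (val a n))) /\
      bijective phi.

Definition formal_fiber (A : subringClosed T) (P : set (subring_of A)) :
    set (set T) :=
  [set Q | prime_ideal Q /\ [set x : subring_of A | Q (val x)] = P].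

Definition maximal_elements (F : set (set T)) : set (set T) :=
  [set Q | F Q /\ forall Q', F Q' -> Q `<=` Q' -> Q' = Q].

Definition prime_subring : set T := [set x | exists z : int, x = z%:~R].

Definition subring_gen (S : set T) : set T :=
  [set x | forall B : subringClosed T, S `<=` [set y | y \in B] -> x \in B].

(* F_B `&` Q, where F_B is the quotient field of the subring B inside the total
   quotient ring of T; meaningful when the nonzero elements of B are regular in T. *)
Definition quotient_field_cap (B Q : set T) : set T :=
  [set x | Q x /\ exists r s, [/\ B r, B s, s <> 0 & s * x = r]].

End Subrings.

Arguments prime_subring T : clear implicits.

(* Main.v *)
Require Import Defs.
From HB Require Import structures.
From mathcomp Require Import all_boot all_algebra.
From mathcomp Require Import boolp classical_sets functions cardinality wochoice.
From mathcomp Require Import ring.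

Set Implicit Arguments.
Unset Strict Implicit.
Unset Printing Implicit Defensive.

Import GRing.Theory.
Local Open Scope classical_set_scope.
Local Open Scope ring_scope.

(** Necessity.  Let [A] be a local domain with completion [T] and take for [q i] the given
    prime element of [A].  The maximal ideal [m] of [A] generates that of [T], and ideals of
    [A] are contracted from their extensions to [T], by Krull's intersection theorem
    ([extend_contract]).  Hence an element of [A] outside a prime [P] of [A] is regular on
    [T / P T] ([regular_extend]), which is the part of flatness that is needed.  For [P = 0]
    this says that nonzero elements of [A] are regular in [T]; for [P = p A] it says that the
    associated primes of [T / p T] lie in the formal fiber at [p A], hence below its maximal
    elements.  An element of [T] that is a fraction of elements of [A] lies in [A], because
    principal ideals are contracted; this gives the condition on the quotient field.

    Sufficiency.  Call a subring [R] of [T] admissible if it contains the fractions of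
    elements of [Pi[q]] that lie in [T], contains every element of [T] that is a fraction of
    its elements, consists of [0] and regular elements, and satisfies
    [R `&` Q `<=` q i T] for [Q] in [C i].  Let the [PP k] enumerate the primes in the [C i]
    together with finitely many primes that contain all zero divisors of [T]; none of them
    is maximal.  An admissible ring stays admissible when an element [t] that is
    transcendental over it modulo every [PP k] is adjoined, followed by all fractions lying
    in [T] ([adjoin_admissible]).  If [R] is smaller than [T] in cardinality, such [t] exist
    in every set [u + z T] with [z] in the maximal ideal and in no [PP k]
    ([generic_exists]): power series in [z] give as many elements as [T] has, distinct modulo
    every [PP k], while over [R] only few elements are algebraic.  Such [z] exist in every
    ideal contained in no [PP k] ([countable_prime_avoidance]).  So two kinds of tasks can be
    performed in a larger admissible ring of the same cardinality: to meet a coset [u + J] of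
    an ideal [J] contained in no [PP k] ([extend_coset]), and to write an element [c] of
    [R] in the ideal that [a_1, ..., a_n] of [R] generate in [T] as a combination of these
    with coefficients in the larger ring ([extend_closure]).

    All tasks are performed along a well-order of [T] with small initial segments
    ([transfinite_union]).  In the union [A], finitely generated ideals are contracted from
    [T], and [A] maps onto [T / M ^ 2]; such a ring is Noetherian and local with completion
    [T] ([local_ring_closed], [completion_iso_closed]).  The elements of [C i] contract to
    [q i A], which is therefore a nonzero prime ideal.  A prime [Q'] of [T] that contains
    [q i] and lies below no element of [C i] lies in no [PP k]; as [A] meets the coset
    [0 + Q'] outside the elements of [C i], the prime [Q'] contracts to more than [q i A]. *)

(** * Cardinals and well-orders *)

Section Cardinals.

Definition embeds U (A : set U) (V : Type) : Prop :=
  exists f : U -> V, forall x y, A x -> A y -> f x = f y -> x = y.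

Definition infinite_type (V : Type) : Prop := embeds [set: nat] V.

Lemma embeds_sub U (A B : set U) V : A `<=` B -> embeds B V -> embeds A V.
Proof. by move=> AB [f fI]; exists f => x y Ax Ay; apply: fI; exact: AB. Qed.

Lemma embeds_trans U (A : set U) V W :
  embeds A V -> embeds [set: V] W -> embeds A W.
Proof.
by move=> [f fI] [g gI]; exists (g \o f) => x y Ax Ay /= /gI -/(_ I I); exact: fI.
Qed.

Lemma embeds_rel U (A : set U) V (v0 : V) (R : U -> V -> Prop) :
  (forall x, A x -> exists v, R x v) ->
  (forall x y v, A x -> A y -> R x v -> R y v -> x = y) -> embeds A V.
Proof.
move=> RT RI.
have /choice[f fP] : forall x, exists v, A x -> R x v.
  move=> x; case: (pselect (A x)) => [/RT[v Rv]|nA]; first by exists v.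
  by exists v0.
exists f => x y Ax Ay fxy; apply: (RI _ _ (f x)) => //; first exact: fP.
by rewrite fxy; exact: fP.
Qed.

(** Two sets are comparable: a maximal partial bijection between them exhausts one of them. *)
Lemma injection_total U (A B : set U) :
  (exists f : U -> U, (forall x, A x -> B (f x)) /\
     (forall x y, A x -> A y -> f x = f y -> x = y)) \/
  (exists f : U -> U, (forall x, B x -> A (f x)) /\
     (forall x y, B x -> B y -> f x = f y -> x = y)).
Proof.
pose P (G : set (U * U)) := [/\ forall p, G p -> A p.1 /\ B p.2,
  forall x y y', G (x, y) -> G (x, y') -> y = y' &
  forall x x' y, G (x, y) -> G (x', y) -> x = x'].
have [F FP Ftot|G [[GAB Gf Gi] Gmax]] := @Zorn_bigcup _ P.
  have two p p' : (\bigcup_(X in F) X) p -> (\bigcup_(X in F) X) p' ->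
      exists2 X, F X & X p /\ X p'.
    move=> [X FX Xp] [Y FY Yp].
    by have [XY|YX] := Ftot _ _ FX FY; [exists Y|exists X]; try split; auto.
  split.
  - by move=> p [X /FP[+ _ _]]; exact.
  - move=> x y y' h h'; have [X /FP[_ Xf _] [Xp Xp']] := two _ _ h h'.
    exact: Xf Xp Xp'.
  - move=> x x' y h h'; have [X /FP[_ _ Xi] [Xp Xp']] := two _ _ h h'.
    exact: Xi Xp Xp'.
have [Acov|/existsNP[a /not_implyP[Aa na]]] :=
    pselect (forall x, A x -> exists y, G (x, y)).
  left; have /choice[f fP] : forall x, exists y, A x -> G (x, y).
    move=> x; case: (pselect (A x)) => [/Acov[y Gy]|nA]; first by exists y.
    by exists x.
  exists f; split=> [x Ax|x y Ax Ay fxy]; first exact: (GAB _ (fP _ Ax)).2.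
  by apply: (Gi _ _ (f x)); [exact: fP|rewrite fxy; exact: fP].
have [Bcov|/existsNP[b /not_implyP[Bb nb]]] :=
    pselect (forall y, B y -> exists x, G (x, y)).
  right; have /choice[f fP] : forall y, exists x, B y -> G (x, y).
    move=> x; case: (pselect (B x)) => [/Bcov[y Gy]|nA]; first by exists y.
    by exists x.
  exists f; split=> [x Ax|x y Ax Ay fxy]; first exact: (GAB _ (fP _ Ax)).1.
  by apply: (Gf (f x)); [exact: fP|rewrite fxy; exact: fP].
exfalso; apply: (Gmax (G `|` [set (a, b)])).
  split=> [|sub]; first by move=> p; left.
  by apply: na; exists b; apply: sub; right.
split.
- by move=> p [/GAB//|->].
- move=> x y y' [h|[ex ey]] [h'|[ex' ey']]; first exact: Gf h h'.
  + by case: na; exists y; rewrite -ex'.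
  + by case: na; exists y'; rewrite -ex.
  + by rewrite ey ey'.
- move=> x x' y [h|[ex ey]] [h'|[ex' ey']]; first exact: Gi h h'.
  + by case: nb; exists x; rewrite -ey'.
  + by case: nb; exists x'; rewrite -ey.
  + by rewrite ex ex'.
Qed.

Section Pairing.
Variable D : Type.

Record pairing := Pairing {
  pset : set D;
  pmap : D -> D -> D;
  pmapS : forall x y, pset x -> pset y -> pset (pmap x y);
  pmapI : forall x y x' y', pset x -> pset y -> pset x' -> pset y' ->
    pmap x y = pmap x' y' -> x = x' /\ y = y' }.

Definition pairing_le (p q : pairing) : bool := `[< pset p `<=` pset q /\
  forall x y, pset p x -> pset p y -> pmap q x y = pmap p x y >].

(** The value at [(x, y)] is taken in any member of the chain whose set contains both. *)
Lemma pairing_chain (F : set pairing) :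
  F !=set0 -> total_on F pairing_le ->
  exists t, forall s, F s -> pairing_le s t.
Proof.
move=> [p0 Fp0] Ftot.
pose S := \bigcup_(p in F) pset p.
have tot p q : F p -> F q -> exists2 r, F r & pairing_le p r /\ pairing_le q r.
  have le_refl r : pairing_le r r by apply/asboolP; split.
  by move=> Fp Fq; case: (Ftot _ _ Fp Fq) => h; [exists q|exists p] => //; split.
have two x y : S x -> S y -> exists2 p, F p & pset p x /\ pset p y.
  move=> [p Fp px] [q Fq qy]; have [r Fr [/asboolP[h _] /asboolP[h' _]]] := tot _ _ Fp Fq.
  by exists r => //; split; auto.
have /choice[m mP] : forall u : D * D, exists z, forall p, F p ->
    pset p u.1 -> pset p u.2 -> z = pmap p u.1 u.2.
  move=> [x y] /=; case: (pselect (S x /\ S y)) => [[Sx Sy]|nS].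
    have [p Fp [px py]] := two _ _ Sx Sy.
    exists (pmap p x y) => q Fq qx qy.
    have [r Fr [/asboolP[h e] /asboolP[h' e']]] := tot _ _ Fp Fq.
    by rewrite -e // -e'.
  by exists x => p Fp px py; case: nS; split; exists p.
have mS x y : S x -> S y -> S (m (x, y)).
  move=> Sx Sy; have [p Fp [px py]] := two _ _ Sx Sy.
  by exists p => //; rewrite (mP _ p) //; exact: pmapS.
have mI x y x' y' : S x -> S y -> S x' -> S y' ->
    m (x, y) = m (x', y') -> x = x' /\ y = y'.
  move=> Sx Sy Sx' Sy'; have [p Fp [px py]] := two _ _ Sx Sy.
  have [q Fq [qx qy]] := two _ _ Sx' Sy'.
  have [r Fr [/asboolP[h _] /asboolP[h' _]]] := tot _ _ Fp Fq.
  rewrite (mP _ r) /=; auto; rewrite (mP _ r) /=; auto.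
  by apply: pmapI; auto.
exists (@Pairing S (fun x y => m (x, y)) mS mI) => s Fs; apply/asboolP; split.
  by move=> x sx; exists s.
by move=> x y sx sy /=; rewrite (mP _ s).
Qed.

(** If a copy [h @` A] of the set [A] of a pairing lies outside [A], the pairing extends to the
    union.  A point of the union is coded by a point of [A] and a bit; the bits [i], [j] of
    two points are absorbed in [A] through the constants [c i j], and the pairs with a new
    point are sent to [h @` A]. *)
Lemma pairing_extend (p : pairing) (h : D -> D) (c : bool -> bool -> D)
  (hN : forall x, pset p x -> ~ pset p (h x))
  (hI : forall x y, pset p x -> pset p y -> h x = h y -> x = y)
  (cS : forall i j, pset p (c i j))
  (cI : forall i j i' j', c i j = c i' j' -> i = i' /\ j = j') :
  exists q : pairing, pairing_le p q /\ pset q = pset p `|` h @` pset p.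
Proof.
pose A := pset p; pose f := pmap p.
pose S := A `|` h @` A.
pose code x (ia : bool * D) := A ia.2 /\ x = if ia.1 then h ia.2 else ia.2.
have codeT x : S x -> exists ia, code x ia.
  by move=> [Ax|[a Aa <-]]; [exists (false, x)|exists (true, a)].
have codeU x ia ia' : code x ia -> code x ia' -> ia = ia'.
  case: ia ia' => [[] a] [[] a'] [] /= Aa -> [] /= Aa' e.
  - by rewrite (hI _ _ Aa Aa' e).
  - by case: (hN _ Aa); rewrite e.
  - by case: (hN _ Aa'); rewrite -e.
  - by rewrite e.
have /choice[k kP] : forall x, exists ia, S x -> code x ia.
  move=> x; case: (pselect (S x)) => [/codeT[ia ?]|nS]; first by exists ia.
  by exists (false, x).
pose m x y := let: (i, a) := k x in let: (j, b) := k y in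
  if i || j then h (f (c i j) (f a b)) else f a b.
have mS x y : S x -> S y -> S (m x y).
  move=> /kP + /kP; rewrite /m; case: (k x) (k y) => [i a] [j b] [/= Aa _] [/= Ab _].
  case: ifP => _; [right|left]; last exact: pmapS.
  by exists (f (c i j) (f a b)) => //; apply: pmapS => //; exact: pmapS.
have mI x y x' y' : S x -> S y -> S x' -> S y' ->
    m x y = m x' y' -> x = x' /\ y = y'.
  move=> /kP + /kP + /kP + /kP; rewrite /m.
  case: (k x) (k y) (k x') (k y') => [i a] [j b] [i' a'] [j' b'].
  move=> [/= Aa ->] [/= Ab ->] [/= Aa' ->] [/= Ab' ->].
  have Af u v : A u -> A v -> A (f u v) by exact: pmapS.
  have Afab := Af _ _ Aa Ab; have Afab' := Af _ _ Aa' Ab'.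
  have Acf := Af _ _ (cS i j) Afab; have Acf' := Af _ _ (cS i' j') Afab'.
  case: ifP => ij; case: ifP => ij' e.
  - have [/cI[-> ->] e2] := pmapI (cS i j) Afab (cS i' j') Afab' (hI _ _ Acf Acf' e).
    by have [-> ->] := pmapI Aa Ab Aa' Ab' e2.
  - by case: (hN _ Acf); rewrite e.
  - by case: (hN _ Acf'); rewrite -e.
  - have [-> ->] := pmapI Aa Ab Aa' Ab' e.
    by move: i j i' j' ij ij' {Acf Acf' e} => [] [] [] [].
exists (@Pairing S m mS mI); split=> //; apply/asboolP; split=> [x|x y Ax Ay] /=; first by left.
have kA z : A z -> k z = (false, z).
  by move=> Az; apply: (codeU z) => //; apply: kP; left.
by rewrite /m !kA.
Qed.

(** A maximal pairing lives on a set [A] that is as large as [D]: either a copy of [A]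
    fits outside [A], which contradicts maximality, or the complement of [A] embeds in [A]
    and two copies of [A] cover [D]. *)
Lemma square_embeds : infinite_type D -> embeds [set: D * D] D.
Proof.
move=> [e eI].
have eI' i j : e i = e j -> i = j by exact: eI.
have fS x y : range e x -> range e y ->
    range e (e (pickle (xget 0%N [set n | e n = x], xget 0%N [set n | e n = y]))).
  by move=> _ _; exists (pickle (xget 0%N [set n | e n = x], xget 0%N [set n | e n = y])).
have fI x y x' y' : range e x -> range e y -> range e x' -> range e y' ->
    e (pickle (xget 0%N [set n | e n = x], xget 0%N [set n | e n = y])) =
    e (pickle (xget 0%N [set n | e n = x'], xget 0%N [set n | e n = y'])) ->
    x = x' /\ y = y'.
  move=> [a _ <-] [b _ <-] [a' _ <-] [b' _ <-].
  have E n : xget 0%N [set m | e m = e n] = n.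
    by apply: xget_unique => // m /=; exact: eI'.
  by rewrite !E => /eI' /(pcan_inj pickleK)[-> ->].
pose p0 := Pairing fS fI.
pose W := {p : pairing | pairing_le p0 p}.
have refl p : pairing_le p p by apply/asboolP; split.
have trans p q r : pairing_le p q -> pairing_le q r -> pairing_le p r.
  move=> /asboolP[pq e1] /asboolP[qr e2]; apply/asboolP; split.
    by move=> x /pq/qr.
  by move=> x y px py; rewrite e2 ?e1 //; auto.
pose w0 : W := exist _ p0 (refl p0).
pose RW (u v : W) := pairing_le (sval u) (sval v).
have [F Ftot|[p pp0] pmax] := @ZL_preorder W w0 RW (fun w => refl _)
    (fun p q r => @trans _ _ _).
  have [[u Fu]|F0] := pselect (F !=set0).
    have [] := @pairing_chain (sval @` F); first by exists (sval u); exists u.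
      by move=> _ _ [v Fv <-] [w Fw <-]; exact: Ftot.
    move=> t tP; have ut : pairing_le (sval u) t by apply: tP; exists u.
    exists (exist _ t (trans _ _ _ (svalP u) ut)) => s Fs.
    by apply: tP; exists s.
  by exists w0 => s Fs; case: F0; exists s.
have {}pmax q : pairing_le p q -> pset q `<=` pset p.
  move=> pq; have := pmax (exist _ q (trans _ _ _ pp0 pq)) pq.
  by move=> /asboolP[].
have [/asboolP[sub0 _]] := pp0.
have rS n : pset p (e n) by apply: sub0; exists n.
pose c (i j : bool) := e (i.*2 + j)%N.
have cI i j i' j' : c i j = c i' j' -> i = i' /\ j = j'.
  by move=> /eI'; case: i j i' j' => [] [] [] [].
have [[h [hS hI]]|[h [hS hI]]] := injection_total (pset p) (~` (pset p)).
  have [q [pq qE]] := pairing_extend hS hI (fun i j => rS _ : pset p (c i j)) cI.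
  case: (hS (e 0%N)) => //; apply: (pmax q) => //; rewrite qE; right.
  by exists (e 0%N).
(* the two copies of the set of [p] are [pmap p (e 0)] and [pmap p (e 1)] of it *)
pose u x := if pselect (pset p x) is left _ then pmap p (e 0%N) x else pmap p (e 1%N) (h x).
have uS x : pset p (u x).
  by rewrite /u; case: pselect => px; apply: pmapS => //; exact: hS.
have uI x y : u x = u y -> x = y.
  rewrite /u; case: pselect => px; case: pselect => py h'.
  - by have [] := pmapI (rS 0) px (rS 0) py h'.
  - by have [/eI'] := pmapI (rS 0) px (rS 1) (hS _ py) h'.
  - by have [/eI'] := pmapI (rS 1) (hS _ px) (rS 0) py h'.
  - by have [_] := pmapI (rS 1) (hS _ px) (rS 1) (hS _ py) h'; exact: hI.
exists (fun xy => pmap p (u xy.1) (u xy.2)) => -[x y] [x' y'] _ _ /= h'.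
by have [/uI -> /uI ->] := pmapI (uS x) (uS y) (uS x') (uS y') h'.
Qed.

Lemma embeds_prod U (A : set U) V (B : set V) :
  infinite_type D -> embeds A D -> embeds B D -> embeds (A `*` B) D.
Proof.
move=> Di [f fI] [g gI]; apply: embeds_trans (square_embeds Di).
exists (fun u => (f u.1, g u.2)) => -[a b] [a' b'] [/= Aa Bb] [/= Aa' Bb'] [ea eb].
by congr (_, _); [exact: fI|exact: gI].
Qed.

(** Iterated pairing loses the length of a sequence, which is therefore recorded. *)
Lemma embeds_seq (U : eqType) (A : set U) :
  infinite_type D -> embeds A D -> embeds [set s : seq U | forall x, x \in s -> A x] D.
Proof.
move=> Di [f fI]; have [pr prI] := square_embeds Di.
have [d _] := Di; pose d0 := d 0%N.
pose enc := foldr (fun x d => pr (f x, d)) d0.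
apply: (@embeds_trans _ _ (nat * D)%type).
  exists (fun s => (size s, enc s)); elim=> [|x s IH] [|y t] //= As At [[es]].
  move=> /prI -/(_ I I) [exy e]; congr (_ :: _).
    by apply: fI => //; [apply: As|apply: At]; rewrite mem_head.
  by apply: IH; [move=> z ?; apply: As|move=> z ?; apply: At|rewrite es e];
     rewrite // inE; apply/orP; right.
rewrite -setXTT; apply: embeds_prod => //.
by exists id.
Qed.
End Pairing.

(** A well-order all of whose initial segments are too small to contain a copy of the
    type: cut an arbitrary well-order at the first place where a segment is too big. *)
Lemma initial_well_order (U : eqType) : exists lt : U -> U -> Prop,
  [/\ well_founded lt, (forall x y z, lt x y -> lt y z -> lt x z),
      (forall x y, [\/ lt x y, x = y | lt y x]) &
      forall x, ~ embeds [set: U] {y | lt y x}].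
Proof.
have [R Rwo] := @well_ordering_principle U.
pose lt x y := R x y /\ x <> y.
have Rrefl x : R x x.
  by have := @wo_chain_reflexive _ R predT; apply => // A _; exact: Rwo.
have Rtot x y : R x y \/ R y x.
  have := @wo_chainW _ R predT (fun A _ => Rwo A) x y erefl erefl.
  by move=> /orP.
have Ranti x y : R x y -> R y x -> x = y.
  move=> xy yx; have := @wo_chain_antisymmetric _ R predT (fun A _ => Rwo A) x y erefl erefl.
  by apply; rewrite xy.
have Rmin (S : set U) : S !=set0 -> exists2 m, S m & forall x, S x -> R m x.
  move=> [a Sa]; have [|m [[mS mP] _]] := Rwo (fun x => `[< S x >]).
    by exists a; apply/asboolP.
  exists m; first by move: mS => /asboolP.
  by move=> x Sx; apply: mP; apply/asboolP.
have ltwf : well_founded lt.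
  move=> x; apply: contrapT => nx.
  have [m nm mP] := Rmin [set x | ~ Acc lt x] (ex_intro _ x nx).
  apply: nm; constructor=> y [Rym ym]; apply: contrapT => ny.
  by apply: ym; apply: Ranti => //; exact: mP.
have Rtrans x y z : R x y -> R y z -> R x z.
  move=> xy yz.
  have [m + mP] := Rmin [set x; y; z] (ex_intro _ x (or_introl (or_introl erefl))).
  move=> [[/= me|/= me]|/= me]; subst m.
  - by apply: mP; right.
  - by rewrite (Ranti x y) //; apply: mP; left; left.
  - by rewrite -(Ranti y z) //; apply: mP; left; right.
have lttr x y z : lt x y -> lt y z -> lt x z.
  move=> [xy nxy] [yz nyz]; split; first exact: Rtrans yz.
  by move=> e; apply: nxy; apply: Ranti => //; rewrite e.
have lttot x y : [\/ lt x y, x = y | lt y x].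
  case: (pselect (x = y)) => [->|nxy]; first by constructor 2.
  by case: (Rtot x y) => h; [constructor 1|constructor 3]; split=> // /esym.
have [[b bP]|nb] := pselect (exists x, embeds [set: U] {y | lt y x}); last first.
  by exists lt; split=> // x hx; apply: nb; exists x.
have [m [f fI] mP] := Rmin [set x | embeds [set: U] {y | lt y x}] (ex_intro _ b bP).
pose g x := sval (f x).
have gI x y : g x = g y -> x = y.
  by move=> /eq_sig_hprop e; apply: fI => //; apply: e => ? ? ?; exact: Prop_irrelevance.
exists (fun x y => lt (g x) (g y)); split.
- move=> x; elim/(well_founded_ind ltwf): (g x) {-2}x (erefl (g x)) => y IH z gz.
  by constructor=> w ltw; apply: (IH (g w)) => //; rewrite -gz.
- by move=> x y z; exact: lttr.
- by move=> x y; case: (lttot (g x) (g y)) => [h|/gI h|h];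
    [constructor 1|constructor 2|constructor 3].
- move=> x [h hI].
  have [Rgm ngm] := svalP (f x).
  apply: (ngm); apply: Ranti => //; apply: mP.
  exists (fun y => exist _ (g (sval (h y))) (svalP (h y))) => y z _ _ [] /gI e.
  apply: hI => //; apply: eq_sig_hprop e => ? ? ?; exact: Prop_irrelevance.
Qed.
End Cardinals.

(** * Ideals in Noetherian local rings *)

Section IdealFacts.
Variable R : comNzRingType.
Implicit Types (I J K L N P S : set R) (x y z a b c : R) (s : seq R).

Lemma ideal0 I : is_ideal I -> I 0. Proof. by case. Qed.
Lemma idealD I x y : is_ideal I -> I x -> I y -> I (x + y).
Proof. by move=> [_ h _]; exact: h. Qed.
Lemma idealMl I a x : is_ideal I -> I x -> I (a * x).
Proof. by move=> [_ _ h]; exact: h. Qed.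
Lemma idealMr I a x : is_ideal I -> I x -> I (x * a).
Proof. by rewrite mulrC; exact: idealMl. Qed.
Lemma idealN I x : is_ideal I -> I x -> I (- x).
Proof. by move=> hI Ix; rewrite -mulN1r; exact: idealMl. Qed.
Lemma idealB I x y : is_ideal I -> I x -> I y -> I (x - y).
Proof. by move=> hI Ix Iy; apply: idealD => //; exact: idealN. Qed.
Lemma idealBr I x y : is_ideal I -> I x -> I (x - y) -> I y.
Proof. by move=> hI Ix Ixy; rewrite -[y](subKr x); exact: idealB. Qed.
Lemma idealDr I x y : is_ideal I -> I x -> I (x + y) -> I y.
Proof. by move=> hI Ix Ixy; rewrite (_ : y = x + y - x); [exact: idealB|ring]. Qed.
Lemma ideal_sum I (T : Type) (r : seq T) (Q : pred T) (F : T -> R) :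
  is_ideal I -> (forall i, Q i -> I (F i)) -> I (\sum_(i <- r | Q i) F i).
Proof.
move=> hI h; elim/big_ind: _ => //; first exact: ideal0.
by move=> x y; exact: idealD.
Qed.

Lemma sub_ideal_gen S : S `<=` ideal_gen S.
Proof. by move=> x Sx J _; exact. Qed.

Lemma ideal_gen_min S J : is_ideal J -> S `<=` J -> ideal_gen S `<=` J.
Proof. by move=> hJ SJ x; exact. Qed.

Lemma ideal_gen_mono S S' : S `<=` S' -> ideal_gen S `<=` ideal_gen S'.
Proof.
move=> h; apply: ideal_gen_min; first exact: ideal_gen_ideal.
by move=> x /h; exact: sub_ideal_gen.
Qed.

Definition ideal_add I J : set R := [set x | exists y z, [/\ I y, J z & x = y + z]].
Definition ideal_mul I J : set R :=
  ideal_gen [set z | exists x y, [/\ I x, J y & z = x * y]].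

Lemma ideal_add_ideal I J : is_ideal I -> is_ideal J -> is_ideal (ideal_add I J).
Proof.
move=> hI hJ; split.
- by exists 0, 0; split; [exact: ideal0..|rewrite addr0].
- move=> _ _ [y [z [Iy Jz ->]]] [y' [z' [Iy' Jz' ->]]].
  by exists (y + y'), (z + z'); split; [exact: idealD..|rewrite addrACA].
- move=> a _ [y [z [Iy Jz ->]]].
  by exists (a * y), (a * z); split; [exact: idealMl..|rewrite mulrDr].
Qed.

Lemma ideal_addl I J : is_ideal J -> I `<=` ideal_add I J.
Proof. by move=> hJ x Ix; exists x, 0; split; rewrite ?addr0 //; exact: ideal0. Qed.
Lemma ideal_addr I J : is_ideal I -> J `<=` ideal_add I J.
Proof. by move=> hI x Ix; exists 0, x; split; rewrite ?add0r //; exact: ideal0. Qed.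

Lemma ideal_mul_ideal I J : is_ideal (ideal_mul I J).
Proof. exact: ideal_gen_ideal. Qed.

Lemma ideal_mul_in I J x y : I x -> J y -> ideal_mul I J (x * y).
Proof. by move=> Ix Jy; apply: sub_ideal_gen; exists x, y. Qed.

Lemma ideal_mul_min I J K : is_ideal K ->
  (forall x y, I x -> J y -> K (x * y)) -> ideal_mul I J `<=` K.
Proof.
by move=> hK h; apply: ideal_gen_min => // _ [x [y [Ix Jy ->]]]; exact: h.
Qed.

Lemma principal_ideal a : is_ideal (principal a).
Proof.
split.
- by exists 0; rewrite mulr0.
- by move=> _ _ [y ->] [z ->]; exists (y + z); rewrite mulrDr.
- by move=> b _ [y ->]; exists (b * y); rewrite mulrCA.
Qed.

Lemma principal_id a : principal a a.
Proof. by exists 1; rewrite mulr1. Qed.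

Lemma principal_min a I : is_ideal I -> I a -> principal a `<=` I.
Proof. by move=> hI Ia _ [y ->]; exact: idealMr. Qed.

Lemma zero_ideal : is_ideal [set (0 : R)].
Proof. by split=> //= [x y -> ->|a x ->]; rewrite ?addr0 ?mulr0. Qed.

Lemma ideal_gen_seqP s x : ideal_gen [set` s] x <->
  exists c : nat -> R, x = \sum_(i < size s) c i * s`_i.
Proof.
pose J := [set x | exists c : nat -> R, x = \sum_(i < size s) c i * s`_i].
split.
  suff : ideal_gen [set` s] `<=` J by exact.
  apply: ideal_gen_min.
    split.
    - by exists (fun=> 0); rewrite big1 // => i _; rewrite mul0r.
    - move=> _ _ [c ->] [d ->]; exists (fun i => c i + d i).
      by rewrite -big_split; apply: eq_bigr => i _; rewrite mulrDl.
    - move=> a _ [c ->]; exists (fun i => a * c i).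
      by rewrite mulr_sumr; apply: eq_bigr => i _; rewrite mulrA.
  move=> y /= /[dup] ys; rewrite -index_mem => ilt.
  exists (fun i => (i == index y s)%:R).
  rewrite (bigD1 (Ordinal ilt)) //= eqxx mul1r nth_index // big1 ?addr0 // => i.
  by rewrite -val_eqE /= => /negbTE ->; rewrite mul0r.
move=> [c ->]; have hg := ideal_gen_ideal [set` s].
by apply: (ideal_sum _ hg) => i _; apply: (idealMl _ hg); apply: sub_ideal_gen; rewrite /= mem_nth.
Qed.

Lemma ideal_add_principalP I a x : is_ideal I ->
  ideal_add I (principal a) x <-> exists c, I (x - c * a).
Proof.
move=> hI; split.
  by move=> [y [_ [Iy [c ->] ->]]]; exists c; rewrite [a * c]mulrC addrK.
move=> [c Ic]; exists (x - c * a), (a * c); split=> //; first by exists c.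
by rewrite [a * c]mulrC subrK.
Qed.

Lemma ideal_exp1 I : is_ideal I -> ideal_exp I 1 = I.
Proof.
move=> hI; apply/seteqP; split.
  by apply: ideal_gen_min => // _ [x [y [Ix _ ->]]]; exact: idealMr.
by move=> x Ix; apply: sub_ideal_gen; exists x, 1; rewrite mulr1.
Qed.

Lemma ideal_expS I n : ideal_exp I n.+1 = ideal_mul I (ideal_exp I n).
Proof. by []. Qed.

Lemma ideal_exp_decr I n : ideal_exp I n.+1 `<=` ideal_exp I n.
Proof.
have hn := ideal_exp_ideal I n.
by rewrite ideal_expS; apply: ideal_mul_min => // x y _; exact: idealMl.
Qed.

Lemma ideal_exp_le I m n : (m <= n)%N -> ideal_exp I n `<=` ideal_exp I m.
Proof.
elim: n => [|n IH]; first by rewrite leqn0 => /eqP ->.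
rewrite leq_eqVlt => /orP[/eqP->//|/IH h]; apply: subset_trans h.
exact: ideal_exp_decr.
Qed.

Lemma ideal_exp_mul I m n x y : ideal_exp I m x -> ideal_exp I n y ->
  ideal_exp I (m + n) (x * y).
Proof.
move=> + Iy; elim: m x => [|m IH] x; rewrite ?add0n.
  by move=> _; apply: idealMl => //; exact: ideal_exp_ideal.
have hS := ideal_exp_ideal I (m.+1 + n).
have hK : is_ideal [set z | ideal_exp I (m.+1 + n) (z * y)].
  split=> [|a b ha hb|a b hb]; rewrite /= ?mul0r ?mulrDl -?mulrA.
  - exact: ideal0 hS.
  - exact: idealD hS ha hb.
  - exact: idealMl hS hb.
move: x; apply: ideal_mul_min => // a b Ia Ib.
by rewrite /mkset -mulrA; exact: ideal_mul_in Ia (IH _ Ib).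
Qed.

Lemma ideal_exp_addP I m n J : is_ideal J ->
  (forall x y, ideal_exp I m x -> ideal_exp I n y -> J (x * y)) ->
  ideal_exp I (m + n) `<=` J.
Proof.
move=> + ; elim: m J => [|m IH] J hJ h.
  by move=> x Ix; rewrite -[x]mul1r; exact: h.
rewrite addSn ideal_expS; apply: ideal_mul_min => // a b Ia.
have hK : is_ideal [set z | J (a * z)].
  split=> /= [|u v hu hv|u v hv]; rewrite ?mulr0 ?mulrDr 1?mulrCA.
  - exact: ideal0.
  - exact: idealD hu hv.
  - exact: idealMl hv.
apply: (IH _ hK) => x y Ix Iy /=; rewrite mulrA; apply: h => //.
exact: ideal_mul_in.
Qed.

Lemma ideal_expX I n x : I x -> ideal_exp I n (x ^+ n).
Proof.
move=> Ix; elim: n => [|n IH] //; rewrite exprS; exact: ideal_mul_in.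
Qed.

Lemma prime_idealX P n x : prime_ideal P -> P (x ^+ n) -> P x.
Proof.
move=> [hP P1 hM]; elim: n => [|n IH]; first by rewrite expr0.
by rewrite exprS => /hM[].
Qed.

Lemma prime_exp P I n : prime_ideal P -> ideal_exp I n `<=` P -> I `<=` P.
Proof. by move=> hP h x Ix; apply: (prime_idealX hP); apply: h; exact: ideal_expX. Qed.

End IdealFacts.

Section Noetherian.
Variable R : comNzRingType.
Hypothesis noeth : noetherian R.
Implicit Types (I J K L N P S : set R) (x y z a b c : R) (s : seq R).

Lemma chain_seq (F : set (set R)) s : F !=set0 -> total_on F subset ->
  [set` s] `<=` \bigcup_(I in F) I -> exists2 I, F I & [set` s] `<=` I.
Proof.
move=> [I0 FI0] Ftot; elim: s => [|a s IH] sF; first by exists I0.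
have [I FI sI] : exists2 I, F I & [set` s] `<=` I.
  by apply: IH => x /= xs; apply: sF; rewrite /= inE xs orbT.
have [J FJ Ja] : (\bigcup_(I in F) I) a by apply: sF; rewrite /= mem_head.
have [IJ|JI] := Ftot _ _ FI FJ; [exists J|exists I] => // x; rewrite /= inE => /orP[/eqP->|] //.
- by move=> /sI /IJ.
- exact: JI.
- exact: sI.
Qed.

(** By Zorn's lemma: the union of a chain is finitely generated, hence equal to a member. *)
Lemma noetherian_max (F : set (set R)) : F !=set0 -> (forall I, F I -> is_ideal I) ->
  exists2 I, F I & forall J, F J -> I `<=` J -> J = I.
Proof.
move=> [I0 FI0] Fid.
pose W := {I | F I}.
pose RW (u v : W) := `[< sval u `<=` sval v >].
have [|||[I FI] Imax] := @ZL_preorder W (exist _ I0 FI0) RW.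
- by move=> t; apply/asboolP.
- by move=> u v w /asboolP uv /asboolP vw; apply/asboolP; exact: subset_trans vw.
- move=> A Atot; have [[u Au]|A0] := pselect (A !=set0); last first.
    by exists (exist _ I0 FI0) => s As; case: A0; exists s.
  pose G := sval @` A; pose U := \bigcup_(I in G) I.
  have Gtot : total_on G subset.
    by move=> _ _ [v Av <-] [w Aw <-]; case: (Atot _ _ Av Aw) => /asboolP ?; [left|right].
  have GF I : G I -> F I by move=> [v _ <-]; exact: svalP.
  have hU : is_ideal U.
    split.
    - by exists (sval u); [exists u|exact: ideal0 (Fid _ (svalP u))].
    - move=> x y [I GI Ix] [J GJ Jy]; have [IJ|JI] := Gtot _ _ GI GJ.
        by exists J => //; apply: idealD => //; [exact/Fid/GF|exact: IJ].
      by exists I => //; apply: idealD => //; [exact/Fid/GF|exact: JI].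
    - by move=> a x [I GI Ix]; exists I => //; apply: idealMl => //; exact/Fid/GF.
  have [s sU] := noeth hU.
  have [||_ [v Av <-] sv] := @chain_seq G s _ Gtot.
  + by exists (sval u); exists u.
  + by rewrite -/U sU; exact: sub_ideal_gen.
  exists v => w Aw; apply/asboolP => x wx.
  have : U x by exists (sval w) => //; exists w.
  by rewrite sU; apply: ideal_gen_min => //; exact: Fid _ (svalP v).
exists I => // J FJ IJ; apply/seteqP; split=> //.
by have /asboolP := Imax (exist _ J FJ) (introT (asboolP _) IJ).
Qed.

(** A maximal one among the ideals generated by finite subsets of [S] contains [S]. *)
Lemma noetherian_gen S : exists2 s : seq R, [set` s] `<=` S &
  ideal_gen S = ideal_gen [set` s].
Proof.
pose F : set (set R) := [set I | exists2 s : seq R, [set` s] `<=` S & I = ideal_gen [set` s]].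
have [||_ [s sS ->] smax] := @noetherian_max F.
- by exists (ideal_gen [set` [::]]); exists [::].
- by move=> _ [s _ ->]; exact: ideal_gen_ideal.
exists s => //; apply/seteqP; split; last exact: ideal_gen_mono.
apply: ideal_gen_min => [|x Sx]; first exact: ideal_gen_ideal.
rewrite -(smax (ideal_gen [set` x :: s])).
- by apply: sub_ideal_gen; rewrite /= mem_head.
- by exists (x :: s) => // y; rewrite /= inE => /orP[/eqP->|/sS].
- by apply: ideal_gen_mono => y ys; rewrite /= inE; apply/orP; right.
Qed.

End Noetherian.

Section Local.
Variable R : comNzRingType.
Variable m : set R.
Hypothesis noeth : noetherian R.
Hypothesis mmax : maximal_ideal m.
Hypothesis muniq : forall m', maximal_ideal m' -> m' = m.
Implicit Types (I J K L N P S : set R) (x y z a b c : R) (s : seq R).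

Let mI : is_ideal m. Proof. by case: mmax. Qed.

(** An ideal maximal among the proper ones containing [I] is maximal, hence is [m]. *)
Lemma sub_maximal I : is_ideal I -> ~ I 1 -> I `<=` m.
Proof.
move=> hI I1.
have [||J [hJ J1 IJ] Jmax] := @noetherian_max R noeth
    [set J | [/\ is_ideal J, ~ J 1 & I `<=` J]].
- by exists I; split.
- by move=> J [].
rewrite -(_ : J = m) //; apply: muniq; split=> // K hK JK.
have [K1|K1] := pselect (K 1); first by right.
by left; apply: Jmax => //; split=> //; exact: subset_trans JK.
Qed.

Lemma local_unit x : ~ m x -> exists y, x * y = 1.
Proof.
move=> nx; apply: contrapT => nu; apply: nx.
apply: (sub_maximal (principal_ideal x)); last exact: principal_id.
by move=> [y xy]; apply: nu; exists y.
Qed.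

Lemma local_unit1 x : m x -> exists y, (1 - x) * y = 1.
Proof.
move=> mx; apply: local_unit => m1x; have [_ m1 _] := mmax; apply: m1.
by rewrite -(subrK x 1); exact: idealD.
Qed.

(** Generators of [N] are discarded one at a time: modulo [I] and the remaining ones,
    a generator [a] is a multiple [c * a] with [c] in [m], and [1 - c] is a unit. *)
Lemma nakayama N I : is_ideal N -> is_ideal I ->
  N `<=` ideal_add I (ideal_mul m N) -> N `<=` I.
Proof.
move=> hN hI NI; have [s sN] := noeth hN.
have {sN} [sN Ns] : [set` s] `<=` N /\ N `<=` ideal_gen (I `|` [set` s]).
  rewrite sN; split; first exact: sub_ideal_gen.
  by apply: ideal_gen_mono => x; right.
elim: s I hI NI sN Ns => [|a s IH] I hI NI sN Ns.
  apply: subset_trans Ns _; apply: ideal_gen_min => // x [//|/=].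
  by rewrite in_nil.
have ha := principal_ideal a.
have hK := ideal_add_ideal hI ha.
have IK := @ideal_addl _ I _ ha.
have aK : ideal_add I (principal a) a by apply: ideal_addr => //; exact: principal_id.
have NK : N `<=` ideal_add I (principal a).
  apply: IH => //.
  - by move=> x /NI[y [z [/IK Iy mz ->]]]; exists y, z.
  - by move=> x xs; apply: sN; rewrite /= inE; apply/orP; right.
  - apply: subset_trans Ns _; apply: ideal_gen_min; first exact: ideal_gen_ideal.
    move=> x [/IK Ix|/=]; first by apply: sub_ideal_gen; left.
    by rewrite inE => /orP[/eqP->|xs]; apply: sub_ideal_gen; [left|right].
have Ia : I a.
  have mNK : ideal_mul m N `<=` [set x | exists2 c, m c & I (x - c * a)].
    apply: ideal_mul_min.
      split=> [|x y [c mc Ic] [d md Id]|b x [c mc Ic]].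
      - by exists 0; [exact: ideal0|rewrite mul0r subr0; exact: ideal0].
      - exists (c + d); first exact: idealD.
        by rewrite (_ : _ - _ = x - c * a + (y - d * a)); [exact: idealD|ring].
      - exists (b * c); first exact: idealMl.
        by rewrite (_ : _ - _ = b * (x - c * a)); [exact: idealMl|ring].
    move=> x y mx /NK/(ideal_add_principalP _ _ hI)[c Ic]; exists (c * x); first exact: idealMl.
    by rewrite (_ : _ - _ = x * (y - c * a)); [exact: idealMl|ring].
  have [y [z [Iy /mNK[c mc Ic] e]]] : ideal_add I (ideal_mul m N) a.
    by apply: NI; apply: sN; rewrite /= mem_head.
  have [u uP] := local_unit1 mc.
  rewrite (_ : a = u * (y + (z - c * a))); first by apply: idealMl => //; exact: idealD.
  by rewrite addrA -e -{2}[a]mul1r -mulrBl mulrA [u * _]mulrC uP mul1r.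
by move=> x /NK/(ideal_add_principalP _ _ hI)[c Ic]; rewrite -(subrK (c * a) x);
  apply: idealD => //; exact: idealMl.
Qed.

(** An ideal maximal among those that contain [L] and no power of [m] is prime; having a
    power of each element of [m], it would contain [m]. *)
Lemma exp_sub_of_nil L : is_ideal L ->
  (forall x, m x -> exists k, L (x ^+ k)) -> exists n, ideal_exp m n `<=` L.
Proof.
move=> hL nil; apply: contrapT => nL.
have [||P [hP LP nP] Pmax] := @noetherian_max R noeth
    [set P | [/\ is_ideal P, L `<=` P & ~ exists n, ideal_exp m n `<=` P]].
- by exists L; split.
- by move=> P [].
have big x : ~ P x -> exists n, ideal_exp m n `<=` ideal_add P (principal x).
  move=> nx; have hx := principal_ideal x; apply: contrapT => nn; apply: nx.
  rewrite -(Pmax (ideal_add P (principal x))).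
  - by apply: ideal_addr => //; exact: principal_id.
  - split=> //; first exact: ideal_add_ideal.
    by apply: subset_trans LP _; exact: ideal_addl.
  - exact: ideal_addl.
have Pprime : prime_ideal P.
  split=> //.
    by move=> P1; apply: nP; exists 0%N => x _; rewrite -[x]mulr1; exact: idealMl.
  move=> x y Pxy; apply: contrapT => /not_orP[/big[k xk] /big[l yl]]; apply: nP.
  exists (k + l)%N; apply: ideal_exp_addP => //.
  move=> u v /xk/(ideal_add_principalP _ _ hP)[c Pc] /yl/(ideal_add_principalP _ _ hP)[d Pd].
  rewrite (_ : u * v = (u - c * x) * v + c * x * (v - d * y) + c * d * (x * y)); last ring.
  by apply: idealD => //; [apply: idealD => //; [exact: idealMr|exact: idealMl]|exact: idealMl].
apply: nP; exists 1%N; rewrite ideal_exp1 // => x /nil[k Lk].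
exact: prime_idealX Pprime (LP _ Lk).
Qed.

(** Krull's intersection theorem.  For [N] the intersection of the [I + m ^ k] and an
    ideal [L] containing [K := I + m N] and maximal with [L `&` N] inside [K], every [x] in
    [m] has a power in [L]; hence [N] lies in [L], that is [N] is inside [I + m N]. *)
Lemma krull_intersection I x : is_ideal I ->
  (forall k, exists2 y, I y & ideal_exp m k (x - y)) -> I x.
Proof.
move=> hI; pose N := [set x | forall k, exists2 y, I y & ideal_exp m k (x - y)].
suff NI : N `<=` I by move=> h; exact: NI.
have hN : is_ideal N.
  split=> [k|y z Ny Nz k|a y Ny k].
  - by exists 0; [exact: ideal0|rewrite subr0; exact: ideal0 (ideal_exp_ideal m k)].
  - have [[y' Iy' hy] [z' Iz' hz]] := (Ny k, Nz k).
    exists (y' + z'); first exact: idealD.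
    by rewrite opprD addrACA; exact: idealD (ideal_exp_ideal m k) hy hz.
  - have [y' Iy' hy] := Ny k; exists (a * y'); first exact: idealMl.
    by rewrite -mulrBr; exact: idealMl (ideal_exp_ideal m k) hy.
have IN : I `<=` N.
  by move=> y Iy k; exists y; rewrite ?subrr //; exact: ideal0 (ideal_exp_ideal m k).
apply: nakayama => //.
have hmN := ideal_mul_ideal m N; have hK := ideal_add_ideal hI hmN.
set K := ideal_add I (ideal_mul m N) in hK *.
have KN : K `<=` N.
  move=> _ [y [z [/IN Ny mz ->]]]; apply: (idealD hN) => //.
  by apply: (@ideal_mul_min _ m N N hN _ z mz) => a b _; exact: (idealMl _ hN).
have [||L [hL KL LN] Lmax] := @noetherian_max R noeth
    [set L | [/\ is_ideal L, K `<=` L & L `&` N `<=` K]].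
- by exists K; split=> // y [].
- by move=> L [].
have [y my|n nL] := @exp_sub_of_nil L hL; last first.
  move=> y Ny; apply: LN; split=> //.
  have [z Iz hz] := Ny n; rewrite -(subrK z y); apply: idealD => //; first exact: nL.
  by apply: KL; exact: ideal_addl.
pose Q k := [set r | L (y ^+ k * r)].
have hQ k : is_ideal (Q k).
  split=> [|a b Qa Qb|a b Qb]; rewrite /Q /mkset ?mulr0 ?mulrDr 1?mulrCA.
  - exact: ideal0.
  - exact: idealD.
  - exact: idealMl.
have [||_ [k _ <-] Qmax] := @noetherian_max R noeth (range Q).
- by exists (Q 0%N); exists 0%N.
- by move=> _ [k _ <-].
exists k.
have QS r : L (y ^+ k.+1 * r) -> L (y ^+ k * r).
  have QE : Q k.+1 = Q k.
    by apply: Qmax; [exists k.+1|move=> s; rewrite /Q /mkset exprS -mulrA; exact: idealMl].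
  by have := congr1 (fun S : set R => S r) QE; rewrite /Q /mkset => ->.
have hyk := principal_ideal (y ^+ k).
rewrite -(Lmax (ideal_add L (principal (y ^+ k)))).
- by apply: ideal_addr => //; exact: principal_id.
- split.
  + exact: ideal_add_ideal.
  + by apply: subset_trans KL _; exact: ideal_addl.
  + move=> z [/(ideal_add_principalP _ _ hL)[c Lc] Nz]; apply: LN; split=> //.
    rewrite -(subrK (c * y ^+ k) z); apply: idealD => //.
    rewrite mulrC; apply: QS.
    rewrite (_ : _ * c = y * z - y * (z - c * y ^+ k)); last by rewrite exprS; ring.
    apply: idealB => //; last exact: idealMl.
    by apply: KL; apply: ideal_addr => //; exact: ideal_mul_in.
- exact: ideal_addl.
Qed.

End Local.

Section Complete.
Variable T : comNzRingType.

Lemma local_ringP : local_ring T -> noetherian T /\ exists2 M : set T,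
  maximal_ideal M & forall M', maximal_ideal M' -> M' = M.
Proof. by move=> [nT [M [hM Mu]]]; split=> //; exists M => // M' /Mu. Qed.

Hypothesis hT : complete_local_ring T.
Variable M : set T.
Hypothesis hM : maximal_ideal M.

(** A coherent sequence is an element of the completion, and [T] maps onto it. *)
Lemma complete_limit (a : nat -> T) : (forall n, ideal_exp M n (a n.+1 - a n)) ->
  exists t, forall n, ideal_exp M n (t - a n).
Proof.
move=> ha; have [_ /(_ _ hM)[g _ gK]] := hT.
have ca : a \in coherent M by apply/asboolP.
pose b : coherent_ring M := exist _ a ca.
exists (g (\pi_(completion M) b)%qT) => n.
have /completion_eqP/asboolP/(_ n) := gK (\pi_(completion M) b)%qT.
by [].
Qed.

Lemma complete_sep x : (forall n, ideal_exp M n x) -> x = 0.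
Proof.
move=> hx; have [_ /(_ _ hM)/bij_inj inj] := hT.
by apply: inj; apply/completion_eqP/asboolP => n; rewrite /= subr0.
Qed.

End Complete.

(** * Zero divisors modulo an ideal *)

Section AssociatedPrimes.
Variable R : comNzRingType.
Hypothesis nR : noetherian R.
Implicit Types (I P : set R) (x y z w v t a : R).

(** The annihilator of the class of [w] in [R / I]. *)
Definition colon I w : set R := [set t | I (t * w)].

Lemma colon_ideal I w : is_ideal I -> is_ideal (colon I w).
Proof.
move=> hI; split=> [|x y hx hy|a x hx]; rewrite /colon /mkset ?mul0r ?mulrDl -?mulrA.
- exact: ideal0.
- exact: idealD.
- exact: idealMl.
Qed.

Definition maximal_colon I w :=
  ~ I w /\ forall v, ~ I v -> colon I w `<=` colon I v -> colon I v = colon I w.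

Lemma maximal_colon_exists I y : is_ideal I -> ~ I y ->
  exists2 w, maximal_colon I w & colon I y `<=` colon I w.
Proof.
move=> hI ny.
have [||_ [w [nw yw ->]] wmax] := @noetherian_max R nR
    [set J | exists w, [/\ ~ I w, colon I y `<=` colon I w & J = colon I w]].
- by exists (colon I y), y; split.
- by move=> _ [w [_ _ ->]]; exact: colon_ideal.
exists w => //; split=> // v nv wv; apply: wmax => //.
by exists v; split=> //; exact: subset_trans wv.
Qed.

(** For [y] outside it, the annihilator of [w] and that of [y w] coincide by maximality. *)
Lemma maximal_colon_prime I w : is_ideal I -> maximal_colon I w -> prime_ideal (colon I w).
Proof.
move=> hI [nw wmax]; split; first exact: colon_ideal.
  by rewrite /colon /mkset mul1r.
move=> x y xy; have [yw|nyw] := pselect (colon I w y); [by right|left].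
rewrite -(wmax (y * w)) //; first by move: xy; rewrite /colon /mkset mulrA.
by move=> t tw; rewrite /colon /mkset mulrCA; exact: idealMl.
Qed.

Lemma associated_prime_exists I x y : is_ideal I -> I (x * y) -> ~ I y ->
  exists2 P, Ass I P & P x.
Proof.
move=> hI xy /(maximal_colon_exists hI)[w mw yw]; exists (colon I w); last exact: yw.
by split; [exact: maximal_colon_prime|exists w].
Qed.

(** Finitely many primes carry all zero divisors: the elements with maximal annihilator
    generate an ideal that finitely many of them generate, and a maximal annihilator,
    being prime, contains one of the annihilators of those. *)
Lemma zero_divisor_primes : exists s : seq R,
  (forall z, z \in s -> z <> 0 /\ prime_ideal (colon [set 0] z)) /\
  forall x y, x * y = 0 -> y <> 0 -> exists2 z, z \in s & x * z = 0.
Proof.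
have h0 := zero_ideal R.
have [s sS e] := noetherian_gen nR [set z | maximal_colon [set 0] z].
exists s; split.
  move=> z zs; have mz := sS z zs; split; last exact: maximal_colon_prime.
  by have [] := mz.
move=> x y xy y0; have [z mz yz] := maximal_colon_exists h0 y0.
have [_ P1 PM] := maximal_colon_prime h0 mz.
suff [w ws wz] : exists2 w, w \in s & colon [set 0] w `<=` colon [set 0] z.
  exists w => //; have [_ wmax] := sS w ws; have [nz _] := mz.
  by have := yz x xy; rewrite (wmax z nz wz).
apply: contrapT => ns.
have [a [aw az]] : exists a, (forall w, w \in s -> a * w = 0) /\ ~ colon [set 0] z a.
  elim: s ns {sS e} => [|v s IH] ns; first by exists 1; split.
  have [|a [aw az]] := IH; first by move=> [w ws h]; apply: ns; exists w => //; rewrite inE ws orbT.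
  have /existsNP[b /not_implyP[bv bz]] : ~ (colon [set 0] v `<=` colon [set 0] z).
    by move=> h; apply: ns; exists v => //; exact: mem_head.
  exists (a * b); split=> [w|/PM[]//].
  rewrite inE => /orP[/eqP->|/aw h]; first by rewrite -mulrA bv mulr0.
  by rewrite mulrAC h mul0r.
apply: az; rewrite /colon /mkset /=.
have : ideal_gen [set` s] z by rewrite -e; exact: sub_ideal_gen.
have ha : is_ideal [set w | a * w = 0].
  split=> [|u w hu hw|u w hw]; rewrite /mkset ?mulr0 //.
    by rewrite mulrDr hu hw addr0.
  by rewrite mulrCA hw mulr0.
by apply: (ideal_gen_min ha) => w /aw.
Qed.

End AssociatedPrimes.

(** * Extension of ideals of a subring *)

Section CoherentFacts.
Variables (R : comNzRingType) (I : set R).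
Implicit Types a b : coherent_ring I.

Lemma coherentD a b n : val (a + b) n = val a n + val b n. Proof. by []. Qed.
Lemma coherentB a b n : val (a - b) n = val a n - val b n. Proof. by []. Qed.
Lemma coherentM a b n : val (a * b) n = val a n * val b n. Proof. by []. Qed.
Lemma coherent1 n : val (1 : coherent_ring I) n = 1. Proof. by []. Qed.
Lemma coherentP a n : ideal_exp I n (val a n.+1 - val a n).
Proof. by have /asboolP := svalP a. Qed.

Lemma completion_eq_sub a b :
  (\pi_(completion I) a = \pi_(completion I) b)%qT <->
  forall n, ideal_exp I n (val a n - val b n).
Proof.
split=> [/completion_eqP/asboolP h n|h]; first by rewrite -coherentB.
by apply/completion_eqP/asboolP => n; rewrite coherentB.
Qed.

Lemma completion_piD a b :
  (\pi_(completion I) (a + b) = \pi_(completion I) a + \pi_(completion I) b)%qT.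
Proof.
exact: (raddfD (\pi_(completion I)%qT : coherent_ring I -> Quotient.quot (null_coherent (I:=I)))).
Qed.

Lemma completion_piM a b :
  (\pi_(completion I) (a * b) = \pi_(completion I) a * \pi_(completion I) b)%qT.
Proof. by rewrite -completion_mulE. Qed.

Lemma completion_pi1 : (\pi_(completion I) 1 = 1)%qT.
Proof. by []. Qed.

End CoherentFacts.

Section Extension.
Variables (T : comNzRingType) (A : subringClosed T).
Implicit Types (x y z : subring_of A) (t u : T) (I : set (subring_of A)).

Definition extend I : set T := ideal_gen (val @` I).

Lemma extend_ideal I : is_ideal (extend I). Proof. exact: ideal_gen_ideal. Qed.

Lemma extend_in I x : I x -> extend I (val x).
Proof. by move=> Ix; apply: sub_ideal_gen; exists x. Qed.

Lemma extend_min I (K : set T) : is_ideal K -> (forall x, I x -> K (val x)) ->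
  extend I `<=` K.
Proof. by move=> hK h; apply: ideal_gen_min => // _ [x Ix <-]; exact: h. Qed.

Variables (M : set T) (m : set (subring_of A)).
Hypothesis maximal_contract : forall x, M (val x) <-> m x.

(** If [A] maps onto [T / M ^ 2] then [M = m T + M ^ 2], and Nakayama's lemma applies. *)
Lemma extend_maximal : noetherian T -> maximal_ideal M ->
  (forall M', maximal_ideal M' -> M' = M) ->
  (forall t, exists x : subring_of A, ideal_exp M 2 (t - val x)) -> M = extend m.
Proof.
move=> nT hM Muniq dense2; have [MI _ _] := hM; have hE := extend_ideal m.
apply/seteqP; split; last by apply: extend_min => // x /maximal_contract.
apply: (nakayama nT hM Muniq) => // t Mt.
have [x hx] := dense2 t.
have hM2 : ideal_mul M M (t - val x) by move: hx; rewrite ideal_expS ideal_exp1.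
exists (val x), (t - val x); split=> //; last by rewrite addrC subrK.
apply: extend_in; apply/maximal_contract; rewrite -(subKr t (val x)).
by apply: idealB => //; apply: (@ideal_mul_min _ M M M MI _ _ hM2) => a b _; exact: idealMl.
Qed.

Hypothesis maximal_extend : M = extend m.

Lemma exp_extend n : ideal_exp M n `<=` extend (ideal_exp m n).
Proof.
elim: n => [|n IH].
  move=> t _; rewrite -[t]mulr1 -(rmorph1 (val : subring_of A -> T)).
  by apply: (idealMl _ (extend_ideal _)); exact: extend_in.
have hE := extend_ideal (ideal_exp m n.+1).
apply: ideal_mul_min => // t u Mt /IH.
have hK u' : is_ideal [set w | extend (ideal_exp m n.+1) (w * u')].
  split=> [|v w hv hw|v w hw]; rewrite /mkset ?mul0r ?mulrDl -?mulrA.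
  - exact: ideal0 hE.
  - exact: idealD hE hv hw.
  - exact: idealMl hE hw.
have hK' t' : is_ideal [set w | extend (ideal_exp m n.+1) (t' * w)].
  by have := hK t'; rewrite (_ : [set w | _ (t' * w)] = [set w | extend (ideal_exp m n.+1) (w * t')]) //;
     apply/funext => w; rewrite /mkset mulrC.
move: u; apply: (extend_min (hK' t)) => y my; rewrite /mkset.
move: t Mt; rewrite maximal_extend; apply: (extend_min (hK (val y))) => x mx.
by rewrite /mkset -rmorphM; apply: extend_in; exact: ideal_mul_in.
Qed.

Lemma exp_val x n : ideal_exp m n x -> ideal_exp M n (val x).
Proof.
elim: n x => // n IH x.
have hK : is_ideal [set y : subring_of A | ideal_exp M n.+1 (val y)].
  split=> [|y z hy hz|y z hz]; rewrite /mkset ?rmorph0 ?rmorphD ?rmorphM.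
  - exact: ideal0 (ideal_exp_ideal M n.+1).
  - exact: idealD (ideal_exp_ideal M n.+1) hy hz.
  - exact: idealMl (ideal_exp_ideal M n.+1) hz.
move: x; apply: (ideal_mul_min hK) => y z /maximal_contract My /IH Mz.
by rewrite /mkset rmorphM; exact: ideal_mul_in.
Qed.

End Extension.

Section Descent.
Variables (T : comNzRingType) (M : set T).
Hypothesis hT : complete_local_ring T.
Hypothesis hM : maximal_ideal M.
Hypothesis Muniq : forall M', maximal_ideal M' -> M' = M.
Variable A : subringClosed T.
Variable m : set (subring_of A).
Hypothesis hA : local_domain A.
Hypothesis hm : maximal_ideal m.
Hypothesis muniq : forall m', maximal_ideal m' -> m' = m.
Hypothesis hiso : completion_iso A.

Implicit Types (x y z a b c : subring_of A) (t u : T) (I J P : set (subring_of A)).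

Let nT : noetherian T. Proof. by case: hT => [[]]. Qed.
Let nA : noetherian (subring_of A). Proof. by case: hA => [[]]. Qed.
Let MI : is_ideal M. Proof. by case: hM. Qed.
Let mI : is_ideal m. Proof. by case: hm. Qed.
Let MnI n : is_ideal (ideal_exp M n). Proof. exact: ideal_exp_ideal. Qed.
Let mnI n : is_ideal (ideal_exp m n). Proof. exact: ideal_exp_ideal. Qed.

Definition constant x : coherent_ring m := exist _ (fun=> x) (coherent_cst m x).

(** The natural isomorphism in the form in which it is used: on coherent sequences. *)
Lemma completion_iso_data : exists phi : {rmorphism completion m -> T},
  [/\ forall (a : coherent_ring m) n, ideal_exp M n (phi (\pi_(completion m)%qT a) - val (val a n)),
      forall t, exists a : coherent_ring m, phi (\pi_(completion m)%qT a) = t &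
      forall a b : coherent_ring m, phi (\pi_(completion m)%qT a) = phi (\pi_(completion m)%qT b) ->
        forall n, ideal_exp m n (val a n - val b n)].
Proof.
have [phi [phiP phib]] := hiso hm hM; exists phi; split=> //.
  have [g _ gK] := phib.
  by move=> t; exists (repr (g t)); rewrite reprK.
by move=> a b /(bij_inj phib)/completion_eq_sub.
Qed.

Lemma phi_constant (phi : {rmorphism completion m -> T}) x :
  (forall (a : coherent_ring m) n, ideal_exp M n (phi (\pi_(completion m)%qT a) - val (val a n))) ->
  phi (\pi_(completion m)%qT (constant x)) = val x.
Proof.
move=> phiP; apply/eqP; rewrite -subr_eq0; apply/eqP.
by apply: (complete_sep hT hM) => n; exact: phiP.
Qed.

Lemma dense t n : exists x, ideal_exp M n (t - val x).
Proof.
have [phi [phiP phiS _]] := completion_iso_data.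
by have [a <-] := phiS t; exists (val a n).
Qed.

(** An element of [m] that is a unit of [T] would be a unit of the completion of [A], although
    it is [0] modulo [m]. *)
Lemma maximal_contract x : M (val x) <-> m x.
Proof.
have [_ m1 _] := hm; have [_ M1 _] := hM.
split=> [Mx|mx]; apply: contrapT => nx.
  have [y xy] := local_unit nA muniq nx; apply: M1.
  by rewrite (_ : 1 = val (x * y)); [rewrite rmorphM; exact: idealMr|rewrite xy rmorph1].
have [u xu] := local_unit nT Muniq nx.
have [phi [phiP phiS phiI]] := completion_iso_data.
have [b bu] := phiS u.
have : phi (\pi_(completion m)%qT (constant x * b)) = phi (\pi_(completion m)%qT (constant 1)).
  rewrite completion_piM rmorphM (phi_constant x phiP) bu xu.
  by rewrite (phi_constant 1 phiP) rmorph1.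
move=> /phiI /(_ 1%N); rewrite coherentM (ideal_exp1 mI) => h; apply: m1.
by apply: (idealBr mI _ h); exact: idealMr.
Qed.

Lemma maximal_extend : M = extend m.
Proof. exact: (extend_maximal maximal_contract nT hM Muniq (dense ^~ 2)). Qed.

(** [M ^ n] is generated by [m ^ n], and in the completion the combinations of elements of
    [m ^ n] have their [n]-th component in [m ^ n]. *)
Lemma exp_contract x n : ideal_exp M n (val x) -> ideal_exp m n x.
Proof.
have [phi [phiP phiS phiI]] := completion_iso_data.
pose K := [set t | exists2 b : coherent_ring m, phi (\pi_(completion m)%qT b) = t
   & ideal_exp m n (val b n)].
have hK : is_ideal K.
  split=> [|_ _ [b <- hb] [c <- hc]|t _ [b <- hb]].
  - exists (constant 0); last exact: ideal0 (mnI n).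
    by rewrite phi_constant // rmorph0.
  - exists (b + c); last by rewrite coherentD; exact: idealD (mnI n) hb hc.
    by rewrite completion_piD rmorphD.
  - have [a <-] := phiS t.
    exists (a * b); last by rewrite coherentM; exact: idealMl (mnI n) hb.
    by rewrite completion_piM rmorphM.
move=> /(exp_extend maximal_extend) hx.
have : K (val x).
  apply: (extend_min hK _ hx) => y my; exists (constant y) => //.
  exact: phi_constant.
move=> [b bx hb]; apply: (idealBr (mnI n) hb).
by apply: (phiI b (constant x)); rewrite phi_constant.
Qed.

(** Approximating in [A] the coefficients of a combination of elements of [I] shows that [x]
    is in [I + m ^ k] for every [k], and Krull's intersection theorem applies. *)
Lemma extend_contract I x : is_ideal I -> extend I (val x) -> I x.
Proof.
move=> hI hx; apply: (krull_intersection nA hm muniq) => // k.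
suff [y Iy hy] : exists2 y, I y & ideal_exp M k (val x - val y).
  by exists y => //; apply: exp_contract; rewrite rmorphB.
pose K := [set t | exists2 y, I y & ideal_exp M k (t - val y)].
apply: (@extend_min T A I K _ _ _ hx).
  split=> [|t u [y Iy hy] [z Iz hz]|t u [y Iy hy]].
  - by exists 0; [exact: ideal0|rewrite rmorph0 subr0; exact: ideal0 (MnI k)].
  - exists (y + z); first exact: idealD.
    by rewrite rmorphD opprD addrACA; exact: idealD (MnI k) hy hz.
  - have [a ha] := dense t k; exists (a * y); first exact: idealMl.
    rewrite rmorphM (_ : _ - _ = t * (u - val y) + val y * (t - val a)); last ring.
    by apply: (idealD (MnI k)); exact: idealMl.
by move=> y Iy; exists y; rewrite ?subrr //; exact: ideal0 (MnI k).
Qed.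

(** For a prime [P] of [A], nonzero elements of [A / P] stay regular on [T / P T]:
    if [a t] is in [P T], approximate [t] by elements [c] of [A]; closedness of the ideals
    [P + a m ^ k] of [A] corrects [c] to an element of [P]. *)
Lemma regular_extend P a t : prime_ideal P -> ~ P a ->
  extend P (val a * t) -> extend P t.
Proof.
move=> [hP _ PM] na hat; have hE := extend_ideal P.
apply: (krull_intersection nT hM Muniq) => // k.
have [c hc] := dense t k.
pose aM := [set z | exists2 b, ideal_exp m k b & z = a * b].
have haM : is_ideal aM.
  split=> [|_ _ [y hy ->] [z hz ->]|b _ [y hy ->]].
  - by exists 0; [exact: ideal0 (mnI k)|rewrite mulr0].
  - by exists (y + z); [exact: idealD (mnI k) hy hz|rewrite mulrDr].
  - by exists (b * y); [exact: idealMl (mnI k) hy|rewrite mulrCA].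
have hJ := ideal_add_ideal hP haM; have hEJ := extend_ideal (ideal_add P aM).
have [p [_ [Pp [b mb ->] e]]] : ideal_add P aM (a * c).
  apply: extend_contract => //.
  rewrite rmorphM (_ : _ * _ = val a * t - val a * (t - val c)); last ring.
  apply: (idealB hEJ).
    by apply: extend_min hat => // p Pp; apply: extend_in; exact: ideal_addl.
  have hK : is_ideal [set w | extend (ideal_add P aM) (val a * w)].
    split=> [|v w hv hw|v w hw]; rewrite /mkset ?mulr0 ?mulrDr 1?mulrCA.
    - exact: ideal0 hEJ.
    - exact: idealD hEJ hv hw.
    - exact: idealMl hEJ hw.
  apply: (extend_min hK _ (exp_extend maximal_extend hc)) => b mb; rewrite /mkset -rmorphM.
  by apply: extend_in; apply: ideal_addr => //; exists b.
have /PM[//|Pcb] : P (a * (c - b)) by rewrite mulrBr e addrK.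
exists (val (c - b)); first exact: extend_in.
rewrite rmorphB (_ : t - _ = (t - val c) + val b); last ring.
by apply: (idealD (MnI k)) => //; exact: (exp_val maximal_contract).
Qed.
End Descent.

Lemma extend_principal (T : comNzRingType) (A : subringClosed T) (p : subring_of A) :
  extend (principal p) = principal (val p).
Proof.
apply/seteqP; split.
  apply: extend_min; first exact: principal_ideal.
  by move=> _ [y ->]; exists (val y); rewrite rmorphM.
apply: principal_min; first exact: extend_ideal.
by apply: extend_in; exact: principal_id.
Qed.

Lemma extend_zero (T : comNzRingType) (A : subringClosed T) :
  extend [set (0 : subring_of A)] = [set 0].
Proof.
apply/seteqP; split.
  by apply: extend_min => [|x ->]; [exact: zero_ideal|rewrite rmorph0].
by move=> _ ->; exact: ideal0 (extend_ideal _).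
Qed.

(** * Necessity of the conditions *)

Section Necessity.
Variables (T : comNzRingType) (hT : complete_local_ring T).
Variables (C : nat -> set (set T)) (A : subringClosed T).
Hypotheses (hA : local_domain A) (hiso : completion_iso A).
Variable p : nat -> subring_of A.
Hypothesis pprime : forall i, prime_element (p i).
Hypothesis pC : forall i, C i = maximal_elements (formal_fiber (principal (p i))).

Let Piq := subring_gen (prime_subring T `|` range (fun i => val (p i))).

Lemma necessity :
  [/\ forall i, val (p i) <> 0,
      forall i, (\bigcap_(Q in C i) Q) (val (p i)) /\
        (forall j Q', C j <> C i -> C j Q' -> ~ Q' (val (p i))),
      forall P, Ass [set 0] P -> P `&` Piq = [set 0],
      forall i P', Ass (principal (val (p i))) P' ->
        exists2 Q, C i Q & P' `<=` Q &
      forall i Q, C i Q -> quotient_field_cap Piq Q `<=` principal (val (p i))].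
Proof.
have [lA domA] := hA; have [nA [m hm muniq]] := local_ringP lA.
have [lT _] := hT; have [nT [M hM Muniq]] := local_ringP lT.
have vI (x y : subring_of A) : val x = val y -> x = y by exact: val_inj.
have CQ i Q : C i Q -> prime_ideal Q /\ forall x : subring_of A, Q (val x) <-> principal (p i) x.
  by rewrite pC => -[[hQ e] _]; split=> // x; rewrite -e.
have prin0 : prime_ideal [set (0 : subring_of A)].
  split; [exact: zero_ideal|exact/eqP/oner_neq0|].
  by move=> x y /= /domA/orP[/eqP|/eqP]; [left|right].
have prinp i : prime_ideal (principal (p i)).
  by have [_ h1 h2] := pprime i; split=> //; exact: principal_ideal.
have reg (a : subring_of A) t : a <> 0 -> val a * t = 0 -> t = 0.
  have := @regular_extend T M hT hM Muniq A m hA hm muniq hiso [set 0] a t prin0.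
  by rewrite extend_zero; exact.
have PiqA t : Piq t -> exists a : subring_of A, val a = t.
  move=> /(_ A)h; suff tA : t \in A by exists (exist _ t tA).
  apply: h => _ [[z ->]|[i _ <-]]; first by rewrite /= rpred_int.
  exact: (svalP (p i)).
split.
- by move=> i; have [p0 _ _] := pprime i => h; apply: p0; apply: vI; rewrite h rmorph0.
- move=> i; split=> [Q /CQ[_ h]|j Q' nC CjQ' Qp]; first by apply/h; exact: principal_id.
  have [_ h] := CQ _ _ CjQ'; move: (Qp) => /h[u pu].
  suff e : principal (p j) = principal (p i) by apply: nC; rewrite !pC e.
  have hi := principal_ideal (p i); have hj := principal_ideal (p j).
  have pji : principal (p j) (p i) by exists u.
  apply/seteqP; split; apply: principal_min => //.
  have [p0 pu1 _] := pprime i; have [_ pj1 _] := pprime j.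
  have [_ _ pM] := prinp i.
  have [//|[v uv]] : principal (p i) (p j) \/ principal (p i) u.
    by apply: pM; rewrite -pu; exact: principal_id.
  exfalso; apply: pj1; exists v.
  have : p i * (p j * v - 1) = 0 by rewrite mulrBr mulr1 mulrCA -uv -pu subrr.
  move=> /domA/orP[/eqP//|]; rewrite subr_eq0 => /eqP e; by rewrite e.
- move=> P [hP [x Px]]; have [idP P1 _] := hP.
  apply/seteqP; split=> [t [Pt /PiqA[a at_]]|_ ->]; last first.
    split; first exact: ideal0.
    by move=> B _; rewrite rpred0.
  apply: contrapT => t0; apply: P1; rewrite Px /= mul1r.
  apply: (reg a); first by move=> a0; apply: t0; rewrite -at_ a0 rmorph0.
  by rewrite at_; move: Pt; rewrite Px.
- move=> i P' [hP [x Px]]; have [idP P1 _] := hP.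
  have fibP : formal_fiber (principal (p i)) P'.
    split=> //; apply/seteqP; split=> [a Pa|_ [y ->]]; last first.
      by rewrite /mkset Px rmorphM /mkset -mulrA; exists (val y * x).
    apply: contrapT => na; apply: P1; rewrite Px /= mul1r -extend_principal.
    apply: (@regular_extend T M hT hM Muniq A m hA hm muniq hiso _ a) => //.
    by rewrite extend_principal; move: Pa; rewrite Px.
  have [||Q [fibQ PQ] Qmax] := @noetherian_max T nT
      [set Q | formal_fiber (principal (p i)) Q /\ P' `<=` Q].
  + by exists P'; split.
  + by move=> Q [[[]]].
  exists Q => //; rewrite pC; split=> // Q' fQ' QQ'; apply: Qmax => //.
  by split=> //; exact: subset_trans QQ'.
- move=> i Q CQi x [Qx [r [s [/PiqA[a ar] /PiqA[b bs] s0 e]]]].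
  have [hQ h] := CQ _ _ CQi.
  have [c ac] : principal b a.
    apply: (@extend_contract T M hT hM Muniq A m hA hm muniq hiso); first exact: principal_ideal.
    by rewrite extend_principal ar -e -bs; exists x.
  have xc : x = val c.
    apply/eqP; rewrite -subr_eq0; apply/eqP; apply: (reg b).
      by move=> b0; apply: s0; rewrite -bs b0 rmorph0.
    have vac : val a = val b * val c by rewrite ac rmorphM.
    by rewrite mulrBr -vac ar bs e subrr.
  by move: Qx; rewrite xc => /h[d ->]; rewrite rmorphM; exists (val d).
Qed.
End Necessity.

(** * A criterion for a subring to have completion [T] *)

Lemma seq_preimage (U V : eqType) (f : U -> V) (I : set U) (s' : seq V) :
  [set` s'] `<=` f @` I -> exists2 s, [set` s] `<=` I & s' = [seq f y | y <- s].
Proof.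
elim: s' => [|t s' IH] s'I; first by exists [::].
have [s sI ->] : exists2 s, [set` s] `<=` I & s' = [seq f y | y <- s].
  by apply: IH => u us; apply: s'I; rewrite /= inE; apply/orP; right.
have [y Iy yt] : (f @` I) t by apply: s'I; rewrite /= mem_head.
exists (y :: s); last by rewrite /= yt.
by move=> z; rewrite /= inE => /orP[/eqP->|/sI].
Qed.

Section Ascent.
Variables (T : comNzRingType) (M : set T).
Hypothesis hT : complete_local_ring T.
Hypothesis hM : maximal_ideal M.
Hypothesis Muniq : forall M', maximal_ideal M' -> M' = M.
Variable A : subringClosed T.
Implicit Types (x y z a b c : subring_of A) (t u : T) (I J P : set (subring_of A))
  (s : seq (subring_of A)).
Hypothesis dense2 : forall u, exists a : subring_of A, ideal_exp M 2 (u - val a).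
Hypothesis closed_fg : forall x s,
  ideal_gen [set` [seq val y | y <- s]] (val x) -> ideal_gen [set` s] x.

Let nT : noetherian T. Proof. by case: hT => [[]]. Qed.
Let MI : is_ideal M. Proof. by case: hM. Qed.
Let MnI n : is_ideal (ideal_exp M n). Proof. exact: ideal_exp_ideal. Qed.

Definition contract : set (subring_of A) := [set x | M (val x)].
Let m := contract.

Lemma contract_ideal : is_ideal m.
Proof.
split=> [|x y Mx My|x y My]; rewrite /m /contract /mkset.
- by rewrite rmorph0; exact: ideal0.
- by rewrite rmorphD; exact: idealD.
- by rewrite rmorphM; exact: idealMl.
Qed.

Lemma extend_contract_closed I x : is_ideal I -> extend I (val x) -> I x.
Proof.
move=> hI; have [s' s'I e] := noetherian_gen nT (val @` I).
have [s sI ss'] := seq_preimage s'I.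
rewrite /extend e ss' => /closed_fg; exact: ideal_gen_min.
Qed.

(** The extension of [I] is generated by finitely many elements of [I]; these generate [I],
    since finitely generated ideals are contracted. *)
Lemma noetherian_closed : noetherian (subring_of A).
Proof.
move=> I hI; have [s' s'I e] := noetherian_gen nT (val @` I).
have [s sI ss'] := seq_preimage s'I.
exists s; apply/seteqP; split; last exact: ideal_gen_min.
move=> x Ix; apply: closed_fg; rewrite -ss' -e.
by apply: sub_ideal_gen; exists x.
Qed.

Lemma contract_unit x : ~ m x -> principal x 1.
Proof.
move=> nx; have [u xu] := local_unit nT Muniq nx.
apply: extend_contract_closed; first exact: principal_ideal.
by rewrite extend_principal rmorph1; exists u.
Qed.

Lemma contract_maximal : maximal_ideal m.
Proof.
have [_ M1 _] := hM; split; first exact: contract_ideal.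
  by rewrite /m /contract /mkset rmorph1.
move=> J hJ mJ; have [Jm|/existsNP[x /not_implyP[Jx nx]]] := pselect (J `<=` m).
  by left; apply/seteqP; split.
by right; apply: (principal_min hJ Jx); exact: contract_unit.
Qed.

Lemma contract_uniq m' : maximal_ideal m' -> m' = m.
Proof.
move=> [hI m1 mmax].
have [||] // := mmax m contract_ideal; last first.
  by have [_ ] := contract_maximal.
move=> x mx; apply: contrapT => /contract_unit h; apply: m1.
exact: (principal_min hI mx).
Qed.

Lemma local_ring_closed : local_ring (subring_of A).
Proof.
split; first exact: noetherian_closed.
by exists m; split; [exact: contract_maximal|move=> m' /contract_uniq].
Qed.

Lemma contract_extend : M = extend m.
Proof. by apply: extend_maximal. Qed.

Let mval x n : ideal_exp m n x -> ideal_exp M n (val x).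
Proof. by apply: exp_val. Qed.

Lemma contract_exp x n : ideal_exp M n (val x) -> ideal_exp m n x.
Proof.
move=> /(exp_extend contract_extend); apply: extend_contract_closed.
exact: ideal_exp_ideal.
Qed.

(** Successive approximation: the error is in [M ^ n = m ^ n T], and the coefficients in [T]
    are approximated modulo [M]. *)
Lemma dense_closed n t : exists a, ideal_exp M n (t - val a).
Proof.
elim: n => [|n [a ha]]; first by exists 0.
pose K := [set w | exists2 b, ideal_exp m n b & ideal_exp M n.+1 (w - val b)].
suff [b _ hb] : K (t - val a) by exists (a + b); rewrite rmorphD opprD addrA.
move/(exp_extend contract_extend): ha; apply: extend_min.
  split=> [|u w [b hb ub] [c hc wc]|u w [b hb wb]].
  - exists 0; first exact: ideal0 (ideal_exp_ideal m n).
    by rewrite rmorph0 subr0; exact: ideal0 (MnI n.+1).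
  - exists (b + c); first exact: idealD (ideal_exp_ideal m n) hb hc.
    by rewrite rmorphD opprD addrACA; exact: idealD (MnI n.+1) ub wc.
  - have [c hc] := dense2 u; exists (c * b); first exact: idealMl (ideal_exp_ideal m n) hb.
    rewrite rmorphM (_ : _ - _ = u * (w - val b) + (u - val c) * val b); last ring.
    apply: (idealD (MnI n.+1)); first exact: idealMl (MnI n.+1) wb.
    rewrite -add1n; apply: ideal_exp_mul; last exact: mval.
    exact: ideal_exp_le hc.
by move=> b hb; exists b => //; rewrite subrr; exact: ideal0 (MnI n.+1).
Qed.

Definition limit (a : coherent_ring m) : T :=
  xget 0 [set t | forall n, ideal_exp M n (t - val (val a n))].

Lemma limitP (a : coherent_ring m) n : ideal_exp M n (limit a - val (val a n)).
Proof.
move: n; apply: (@xgetPex _ 0 [set t | forall n, ideal_exp M n (t - val (val a n))]).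
apply: (complete_limit hT hM) => n; rewrite -rmorphB; apply: mval.
exact: coherentP.
Qed.

Lemma limit_uniq (a : coherent_ring m) t : (forall n, ideal_exp M n (t - val (val a n))) -> limit a = t.
Proof.
move=> ht; apply/eqP; rewrite -subr_eq0; apply/eqP; apply: (complete_sep hT hM) => n.
rewrite (_ : _ - t = (limit a - val (val a n)) - (t - val (val a n))); last ring.
by apply: (idealB (MnI n)); [exact: limitP|exact: ht].
Qed.

Definition completion_map (x : completion m) : T := limit (repr x).

Lemma completion_mapE (a : coherent_ring m) : completion_map (\pi_(completion m) a)%qT = limit a.
Proof.
rewrite /completion_map; apply: limit_uniq => n; set b := repr _.
have : (\pi_(completion m) b = \pi_(completion m) a)%qT by rewrite reprK.
move=> /completion_eq_sub/(_ n)/mval; rewrite rmorphB => h.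
rewrite (_ : _ - _ = (limit a - val (val a n)) - (val (val b n) - val (val a n))); last ring.
by apply: (idealB (MnI n)); [exact: limitP|exact: h].
Qed.

Lemma completion_map_zmod : zmod_morphism completion_map.
Proof.
move=> x y; rewrite -[x]reprK -[y]reprK; move: (repr x) (repr y) => a b.
have -> : (\pi_(completion m) a - \pi_(completion m) b = \pi_(completion m) (a - b))%qT.
  by apply/eqP; rewrite subr_eq -completion_piD subrK.
rewrite !completion_mapE; apply: limit_uniq => n.
rewrite coherentB rmorphB.
rewrite (_ : _ - _ = (limit a - val (val a n)) - (limit b - val (val b n))); last ring.
by apply: (idealB (MnI n)); exact: limitP.
Qed.

Lemma completion_map_monoid : monoid_morphism completion_map.
Proof.
split.
  rewrite -completion_pi1 completion_mapE; apply: limit_uniq => n.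
  by rewrite coherent1 rmorph1 subrr; exact: ideal0 (MnI n).
move=> x y; rewrite -[x]reprK -[y]reprK; move: (repr x) (repr y) => a b.
rewrite -completion_piM !completion_mapE; apply: limit_uniq => n.
rewrite coherentM rmorphM.
rewrite (_ : _ - _ = (limit a - val (val a n)) * limit b
   + val (val a n) * (limit b - val (val b n))); last ring.
apply: (idealD (MnI n)); last exact: idealMl (MnI n) (limitP b n).
exact: idealMr (MnI n) (limitP a n).
Qed.

HB.instance Definition _ := GRing.isZmodMorphism.Build _ _ completion_map completion_map_zmod.
HB.instance Definition _ := GRing.isMonoidMorphism.Build _ _ completion_map completion_map_monoid.

Lemma completion_iso_closed : completion_iso A.
Proof.
move=> m' M' /contract_uniq -> /Muniq ->.
exists (completion_map : {rmorphism completion m -> T}); split.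
  by move=> a n; rewrite /= completion_mapE; exact: limitP.
have injm (x y : completion m) : completion_map x = completion_map y -> x = y.
  rewrite -[x]reprK -[y]reprK; move: (repr x) (repr y) => a b.
  rewrite !completion_mapE => e; apply/completion_eq_sub => n.
  apply: contract_exp; rewrite rmorphB.
  rewrite (_ : _ - _ = (limit b - val (val b n)) - (limit a - val (val a n))); last by rewrite e; ring.
  by apply: (idealB (MnI n)); exact: limitP.
have surjm t : exists x : completion m, completion_map x = t.
  have [a aP] := choice (fun n => dense_closed n t).
  have ca : a \in coherent m.
    apply/asboolP => n; apply: contract_exp; rewrite rmorphB.
    rewrite (_ : _ - _ = (t - val (a n)) - (t - val (a n.+1))); last ring.
    by apply: (idealB (MnI n)) => //; exact: ideal_exp_decr.
  exists (\pi_(completion m) (exist _ a ca : coherent_ring m))%qT.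
  by rewrite completion_mapE; exact: limit_uniq.
have [g gP] := choice surjm.
by exists g => // x; apply: injm; rewrite gP.
Qed.

End Ascent.

(** * Countable prime avoidance and generic elements *)

Section Avoidance.
Variables (T : comNzRingType) (M : set T).
Hypothesis hT : complete_local_ring T.
Hypothesis hM : maximal_ideal M.
Hypothesis Muniq : forall M', maximal_ideal M' -> M' = M.
Variable PP : nat -> set T.
Hypothesis Pprime : forall k, prime_ideal (PP k).
Hypothesis PM : forall k, ~ M `<=` PP k.

Implicit Types (x y z t u w : T) (f g : {poly T}) (R J : set T).

Let nT : noetherian T. Proof. by case: hT => [[]]. Qed.
Let MI : is_ideal M. Proof. by case: hM. Qed.
Let MnI n : is_ideal (ideal_exp M n). Proof. exact: ideal_exp_ideal. Qed.
Let PI k : is_ideal (PP k). Proof. by case: (Pprime k). Qed.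

Lemma prime_sub_maximal k : PP k `<=` M.
Proof. by have [h h1 _] := Pprime k; exact: (sub_maximal nT Muniq h h1). Qed.

(** Countable prime avoidance, a Baire category argument: successive approximations are
    pushed out of one more prime at a time, by ever smaller corrections in [J]. *)
Lemma countable_prime_avoidance J : is_ideal J -> (forall k, ~ J `<=` PP k) ->
  exists2 z, J z & forall k, ~ PP k z.
Proof.
move=> hJ nJ.
have step n (v : T * nat) : exists v' : T * nat, J v.1 ->
    [/\ J v'.1, (v.2 < v'.2)%N, ideal_exp M v.2 (v'.1 - v.1) &
     forall y, ideal_exp M v'.2 (y - v'.1) -> ~ PP n y].
  case: v => x e /=; have [Jx|nx] := pselect (J x); last by exists (x, e).
  have [x' [Jx' xx' nx']] : exists x', [/\ J x', ideal_exp M e (x' - x) & ~ PP n x'].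
    have [Px|nPx] := pselect (PP n x); last first.
      by exists x; split=> //; rewrite subrr; exact: ideal0 (MnI e).
    have /existsNP[a /not_implyP[Ja na]] := nJ n.
    have /existsNP[b /not_implyP[Mb nb]] := PM (k := n).
    exists (x + b ^+ e * a); split.
    - by apply: idealD => //; exact: idealMl.
    - by rewrite addrC addKr; apply: (idealMr _ (MnI e)); exact: ideal_expX.
    - move=> /(idealDr (PI n) Px); have [_ _ hP] := Pprime n.
      by move=> /hP[/(prime_idealX (Pprime n))|].
  have [e' ee' he'] : exists2 e', (e < e')%N &
      forall y, ideal_exp M e' (y - x') -> ~ PP n y.
    apply: contrapT => ne; apply: nx'; apply: (krull_intersection nT hM Muniq) => // k.
    apply: contrapT => nk; apply: ne; exists (maxn k e.+1); first by rewrite leq_max ltnSn orbT.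
    move=> y hy Py; apply: nk; exists y => //; rewrite -opprB; apply: (idealN (MnI k)).
    by apply: ideal_exp_le hy; exact: leq_maxl.
  by exists (x', e') => _; split.
have /choice[F FP] : forall nv : nat * (T * nat), exists v' : T * nat, J nv.2.1 ->
    [/\ J v'.1, (nv.2.2 < v'.2)%N, ideal_exp M nv.2.2 (v'.1 - nv.2.1) &
     forall y, ideal_exp M v'.2 (y - v'.1) -> ~ PP nv.1 y].
  by move=> [n v]; exact: step.
pose s := fix s n := if n is n'.+1 then F (n', s n') else (0, 0%N).
have Js n : J (s n).1.
  elim: n => [|n IH] /=; first exact: ideal0.
  by case: (FP (n, s n) IH).
have sP n := FP (n, s n) (Js n).
have se n : (n <= (s n).2)%N.
  elim: n => // n IH; case: (sP n) => _ h _ _; exact: leq_ltn_trans IH h.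
have s1 n : ideal_exp M (s n).2 ((s n.+1).1 - (s n).1) by case: (sP n).
have sd n d : ideal_exp M (s n).2 ((s (n + d)%N).1 - (s n).1) /\ ((s n).2 <= (s (n + d)%N).2)%N.
  elim: d => [|d [IH1 IH2]]; first by rewrite addn0 subrr; split=> //; exact: ideal0 (MnI _).
  rewrite addnS; split.
    rewrite (_ : _ - _ = ((s (n + d).+1).1 - (s (n + d)%N).1) + ((s (n + d)%N).1 - (s n).1)); last ring.
    apply: (idealD (MnI _)) => //; exact: ideal_exp_le IH2 _ (s1 _).
  by apply: leq_trans IH2 _; case: (sP (n + d)%N) => _ /ltnW.
have [z zP] : exists z, forall n, ideal_exp M n (z - (s n).1).
  apply: (complete_limit hT hM) => n; exact: ideal_exp_le (se n) _ (s1 n).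
have zP' n : ideal_exp M (s n).2 (z - (s n).1).
  pose N := (n + (s n).2)%N.
  rewrite (_ : z - _ = (z - (s N).1) + ((s N).1 - (s n).1)); last ring.
  apply: (idealD (MnI _)); last by case: (sd n (s n).2).
  by apply: ideal_exp_le (zP N); exact: leq_addl.
exists z.
  by apply: (krull_intersection nT hM Muniq) => // k; exists (s k).1.
by move=> k; case: (sP k) => _ _ _ h; exact: h _ (zP' k.+1).
Qed.

(** Apply prime avoidance to [M J]. *)
Lemma countable_prime_avoidance_max J : is_ideal J -> (forall k, ~ J `<=` PP k) ->
  exists z, [/\ J z, M z & forall k, ~ PP k z].
Proof.
move=> hJ nJ; have hMJ := ideal_mul_ideal M J.
have [k|z Jz zP] := @countable_prime_avoidance (ideal_mul M J) hMJ.
  have /existsNP[a /not_implyP[Ja na]] := nJ k.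
  have /existsNP[b /not_implyP[Mb nb]] := PM (k := k).
  have [_ _ hP] := Pprime k.
  move=> /(_ (b * a))h; have /hP[] // : PP k (b * a) by apply: h; exact: ideal_mul_in.
exists z; split=> //.
  by apply: (@ideal_mul_min _ M J J hJ _ z Jz) => a b _; exact: idealMl.
by apply: (@ideal_mul_min _ M J M MI _ z Jz) => a b Ma _; exact: idealMr.
Qed.

(** A digit expansion of the elements of [T]: the residue of [t], then those of the
    coefficients of the remainder on generators of [M], and so on. *)
Lemma digits : exists c : T -> nat -> T,
  (forall s s' n, c s n <> c s' n -> ~ M (c s n - c s' n)) /\
  (forall s s', (forall n, c s n = c s' n) -> s = s').
Proof.
pose r x : T := xget 0 [set y | M (x - y)].
have rP x : M (x - r x) by apply: (@xgetPex _ 0 [set y | M (x - y)]); exists x; rewrite /= subrr; exact: ideal0.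
have rE x y : M (x - y) -> r x = r y.
  move=> xy; rewrite /r; congr xget; apply/seteqP; split=> z /= h.
    by rewrite (_ : y - z = (x - z) - (x - y)); [exact: idealB|ring].
  by rewrite (_ : x - z = (x - y) + (y - z)); [exact: idealD|ring].
have [g gM] := nT MI.
have /choice[k kP] : forall x, exists k : nat -> T, M x -> x = \sum_(i < size g) k i * g`_i.
  move=> x; have [Mx|nx] := pselect (M x); last by exists (fun=> 0).
  by have [|k ->] := (ideal_gen_seqP g x).1; [rewrite -gM|exists k].
pose dig := fix dig t (w : seq nat) := if w is i :: w' then dig (k (t - r t) i) w' else r t.
have dr t (wd : seq nat) : exists x, dig t wd = r x.
  by elim: wd t => [|i w IH] t /=; [exists t|exact: IH].
exists (fun t n => dig t (odflt [::] (unpickle n))); split.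
  move=> s s' n; have [x ->] := dr s (odflt [::] (unpickle n)).
  have [x' ->] := dr s' (odflt [::] (unpickle n)).
  move=> ne Mr; apply: ne; apply: rE.
  rewrite (_ : x - x' = (x - r x) + (r x - r x') - (x' - r x')); last ring.
  by apply: idealB => //; exact: idealD.
move=> s s' e; apply/eqP; rewrite -subr_eq0; apply/eqP; apply: (complete_sep hT hM) => n.
have {e} : forall wd, dig s wd = dig s' wd by move=> wd; have := e (pickle wd); rewrite pickleK.
elim: n s s' => // n IH s s' e.
have e0 : r s = r s' := e [::].
rewrite (_ : s - s' = (s - r s) - (s' - r s')); last by rewrite e0; ring.
rewrite {1}(kP _ (rP s)) {1}(kP _ (rP s')) -sumrB.
apply: (ideal_sum _ (MnI n.+1)) => i _; rewrite -mulrBl mulrC; apply: ideal_mul_in.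
  by rewrite gM; apply: sub_ideal_gen; rewrite /= mem_nth.
by apply: IH => wd; exact: e (nat_of_ord i :: wd).
Qed.

Section PowerSeries.
Variable z : T.
Hypothesis Mz : M z.

(** The sum of the [d i * z ^+ i], as a limit in [T]. *)
Definition power_series (d : nat -> T) : T :=
  xget 0 [set t | forall n, ideal_exp M n (t - \sum_(i < n) d i * z ^+ i)].

Lemma power_seriesP d n : ideal_exp M n (power_series d - \sum_(i < n) d i * z ^+ i).
Proof.
move: n; apply: (@xgetPex _ 0 [set t | forall n, ideal_exp M n (t - \sum_(i < n) d i * z ^+ i)]).
apply: (complete_limit hT hM) => n; rewrite big_ord_recr /= addrAC subrr add0r.
by apply: (idealMl _ (MnI n)); exact: ideal_expX.
Qed.

Lemma power_seriesS d : power_series d = d 0%N + z * power_series (fun n => d n.+1).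
Proof.
apply/eqP; rewrite -subr_eq0; apply/eqP; apply: (complete_sep hT hM) => n.
apply: (@ideal_exp_decr _ M n).
have h1 := power_seriesP d n.+1.
have h2 := power_seriesP (fun n => d n.+1) n.
rewrite big_ord_recl /= expr0 mulr1 in h1.
set S := \sum_(i < n) _ in h1; set S' := \sum_(i < n) _ in h2.
have SE : S = z * S'.
  rewrite mulr_sumr; apply: eq_bigr => i _.
  by rewrite /= /bump /= add1n exprS mulrCA.
set a := power_series _ in h1 *; set b := power_series _ in h2 *.
rewrite (_ : a - _ = (a - (d 0%N + S)) - z * (b - S')); last by rewrite SE; ring.
apply: (idealB (MnI n.+1)) => //; exact: ideal_mul_in.
Qed.

(** The factor [v] is the difference of the first differing digits plus a multiple of [z]. *)
Lemma power_series_diff d d' n : (forall i, (i < n)%N -> d i = d' i) ->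
  ~ M (d n - d' n) -> exists2 v, ~ M v & power_series d - power_series d' = z ^+ n * v.
Proof.
elim: n d d' => [|n IH] d d' e ne.
  rewrite expr0; exists (power_series d - power_series d'); last by rewrite mul1r.
  rewrite [in X in _ (X - _)]power_seriesS [in X in _ (_ - X)]power_seriesS => h; apply: ne.
  set a := power_series _ in h; set b := power_series _ in h.
  rewrite (_ : _ - _ = (d 0%N + z * a - (d' 0%N + z * b)) - z * (a - b)); last ring.
  by apply: idealB => //; exact: idealMr.
have [i lin|//|v nv e'] := IH (fun n => d n.+1) (fun n => d' n.+1); first exact: e.
exists v => //; rewrite power_seriesS (power_seriesS d') (e 0%N) // opprD addrACA subrr add0r.
by rewrite -mulrBr e' exprS mulrA.
Qed.

End PowerSeries.

Definition avoids z := forall k, ~ PP k z.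

(** As many elements as [T] has, pairwise distinct modulo every [PP k]: two power series
    in [z] with different digits differ by a power of [z] times a unit. *)
Lemma separated_family z : M z -> avoids z ->
  exists w : T -> T, forall s s' k, s <> s' -> ~ PP k (w s - w s').
Proof.
move=> Mz zP; have [c [c1 c2]] := digits.
exists (fun s => power_series z (c s)) => s s' k ne.
have [n cn nmin] : exists2 n, c s n <> c s' n & forall i, (i < n)%N -> c s i = c s' i.
  have ex : exists n, c s n != c s' n.
    apply: contrapT => /forallNP h; apply: ne; apply: c2 => n.
    by have /negP := h n; rewrite negbK => /eqP.
  case: (ex_minnP ex) => n /eqP cn nmin; exists n => // i lin.
  by apply/eqP/negPn/negP => /nmin; rewrite leqNgt lin.
have [v nv ->] := power_series_diff Mz nmin (c1 _ _ _ cn).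
have [_ _ hP] := Pprime k; move=> /hP[/(prime_idealX (Pprime k))|/prime_sub_maximal]; last exact: nv.
exact: zP.
Qed.

Lemma avoiding_exists : exists2 z, M z & avoids z.
Proof. by have [k|z [_ Mz zP]] := @countable_prime_avoidance_max M MI; [exact: PM|exists z]. Qed.

(** Cantor's diagonal argument on the digits [0] and [1]. *)
Lemma uncountable : ~ embeds [set: T] nat.
Proof.
have [z Mz zP] := avoiding_exists; move=> [f fI].
have [_ M1 _] := hM.
pose d (b : nat -> bool) n : T := (b n)%:R.
have dI b b' : power_series z (d b) = power_series z (d b') -> b = b'.
  move=> e; apply/funext => n; elim/ltn_ind: n => n IH.
  apply/eqP/negPn/negP => ne.
  have [i lin||v nv] := @power_series_diff z Mz (d b) (d b') n.
  - by rewrite /d IH.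
  - move=> h; apply: M1; move: h; rewrite /d; case: (b n) (b' n) ne => [] [] // _.
      by rewrite subr0.
    by move=> /(idealN MI); rewrite opprB subr0.
  rewrite e subrr => /esym zv; have [_ _ hP] := Pprime 0.
  have /hP[] : PP 0 (z ^+ n * v) by rewrite zv; exact: ideal0.
    by move=> /(prime_idealX (Pprime 0)); exact: zP.
  by move=> /prime_sub_maximal.
have [b bP] : exists b : nat -> bool, forall b', b (f (power_series z (d b'))) = ~~ b' (f (power_series z (d b'))).
  exists (fun n => `[< exists b', f (power_series z (d b')) = n /\ ~~ b' n >]) => b'.
  apply/asboolP/idP => [[b'' [/(fI _ _ I I)/dI ->]]//|h].
  by exists b'.
by have := bP b; case: (b _).
Qed.

(** Linear factors are split off modulo [P]; the quotient vanishes at the remaining points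
    because their differences with the first one are not in [P]. *)
Lemma roots_mod_prime (P : set T) n f (r : nat -> T) : prime_ideal P ->
  (forall i j, (i < j < n)%N -> ~ P (r j - r i)) ->
  (size f <= n)%N -> (forall i, (i < n)%N -> P f.[r i]) -> forall j, P f`_j.
Proof.
move=> hP; have [hI _ hM'] := hP.
elim: n f r => [|n IH] f r rP sf froot j.
  by move: sf; rewrite leqn0 size_poly_eq0 => /eqP ->; rewrite coef0; exact: ideal0.
have Pc : P f.[r 0%N] by exact: froot.
have /factor_theorem[g fg] : root (f - f.[r 0%N]%:P) (r 0%N) by rewrite rootE !hornerE subrr.
have gP : forall i, P g`_i.
  apply: (IH g (fun i => r i.+1)).
  - by move=> i j' ij; exact: rP.
  - have [->|g0] := eqVneq g 0; first by rewrite size_poly0.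
    have := congr1 (size \o polyseq) fg; rewrite /= size_Mmonic ?monicXsubC // size_XsubC addn2 /=.
    move=> sg; have : (size g < n.+1)%N; last by rewrite ltnS.
    rewrite -sg; apply: leq_trans (size_polyD _ _) _; rewrite size_polyN geq_max sf /=.
    by apply: leq_trans (size_polyC_leq1 _) _.
  - move=> i lin; have := congr1 (fun h => h.[r i.+1]) fg; rewrite !hornerE => e.
    have /hM'[] : P (g.[r i.+1] * (r i.+1 - r 0%N)) by rewrite -e; apply: idealB => //; exact: froot.
      by [].
    by move=> h; case: (rP 0%N i.+1).
rewrite -(subrK f.[r 0%N]%:P f) coefD; apply: idealD => //.
  by rewrite fg coefM; apply: ideal_sum => // i _; exact: idealMr.
by rewrite coefC; case: ifP => // _; exact: ideal0.
Qed.

Definition poly_over R f := forall i, R f`_i.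

(** Transcendence over [R] modulo every [PP k]. *)
Definition generic R t := forall k f, poly_over R f -> PP k f.[t] -> forall i, PP k f`_i.

(** If no member of a separated family were generic, each would be one of the finitely
    many roots of some polynomial over [R] modulo some [PP k], and [T] would embed in [D]. *)
Lemma generic_exists (D : Type) R u z : infinite_type D -> embeds R D ->
  ~ embeds [set: T] D -> M z -> avoids z -> exists w, generic R (u + z * w).
Proof.
move=> Di RD TD Mz zP; have [w wP] := separated_family Mz zP.
apply: contrapT => ng; apply: TD.
have /choice[F FP] : forall s, exists kf : nat * {poly T}, [/\ poly_over R kf.2,
    PP kf.1 kf.2.[u + z * w s] & exists i, ~ PP kf.1 kf.2`_i].
  move=> s; apply: contrapT => ns; apply: ng; exists (w s) => k f Rf Pf i.
  by apply: contrapT => nf; apply: ns; exists (k, f); split=> //; exists i.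
have fin kf : finite_set [set s | F s = kf].
  apply: contrapT => /(infinite_set_fset (size kf.2).+1)[B Bs sB].
  pose ss := finmap.enum_fset B.
  have ssP i : (i < size ss)%N -> F ss`_i = kf by move=> lis; apply: Bs; rewrite /= mem_nth.
  have su : uniq ss by exact: finmap.fset_uniq.
  have F0 : F ss`_0 = kf by apply: ssP; exact: leq_ltn_trans sB.
  have [_ _ [j]] := FP ss`_0; rewrite F0; apply.
  apply: (@roots_mod_prime (PP kf.1) (size ss) kf.2 (fun i => u + z * w ss`_i)) => //; last 2 first.
  - exact: ltnW.
  - by move=> i /ssP Fi; have [_ + _] := FP ss`_i; rewrite Fi.
  - move=> i i' /andP[ii' i's].
    rewrite (_ : _ - _ = z * (w ss`_i' - w ss`_i)); last ring.
    have [_ _ hP] := Pprime kf.1; move=> /hP[|]; first exact: zP.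
    apply: wP => /eqP; rewrite nth_uniq // ?(ltn_trans ii') //.
    by rewrite gtn_eqF.
have /choice[h hP] : forall kf, exists h : T -> nat, {in [set s | F s = kf] &, injective h}.
  by move=> kf; apply/countable_injP; exact: finite_set_countable.
have [e eI] : embeds ([set: nat] `*` ([set s : seq T | forall x, x \in s -> R x] `*` [set: nat])) D.
  by do 2?[apply: embeds_prod => //]; exact: embeds_seq.
exists (fun s => e ((F s).1, ((F s).2 : seq T, h (F s) s))) => s s' _ _.
have Fs t : [set s : seq T | forall x, x \in s -> R x] (F t).2.
  by move=> x /(nthP 0)[i _ <-]; have [Rf _ _] := FP t.
move=> ee; have [e1 /poly_inj e2 e3] := eI (_, (_, _)) (_, (_, _))
  (conj I (conj (Fs s) I)) (conj I (conj (Fs s') I)) ee.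
have Fss : F s = F s' by case: (F s) (F s') e1 e2 => [? ?] [? ?] /= -> ->.
by apply: (hP (F s)); [rewrite inE|rewrite inE /= Fss|rewrite e3 Fss].
Qed.
End Avoidance.

(** * Subrings as sets *)

Section SubringSets.
Variable T : comNzRingType.
Implicit Types (R : set T) (x y : T) (f g : {poly T}).

Definition subring_set R :=
  [/\ R 1, forall x y, R x -> R y -> R (x - y) & forall x y, R x -> R y -> R (x * y)].

Definition regular x := forall y, x * y = 0 -> y = 0.

Lemma regularM x y : regular x -> regular y -> regular (x * y).
Proof. by move=> hx hy z; rewrite -mulrA => /hx/hy. Qed.

Lemma regularX x n : regular x -> regular (x ^+ n).
Proof.
move=> hx; elim: n => [|n IH]; first by move=> y; rewrite expr0 mul1r.
by rewrite exprS; exact: regularM.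
Qed.

Lemma regular_neq0 x : regular x -> x <> 0.
Proof. by move=> hx x0; have /eqP := oner_neq0 T; apply; apply: hx; rewrite x0 mul0r. Qed.

Lemma regularI x y z : regular x -> x * y = x * z -> y = z.
Proof. by move=> hx e; apply/eqP; rewrite -subr_eq0; apply/eqP/hx; rewrite mulrBr e subrr. Qed.

Variable R : set T.
Hypothesis hR : subring_set R.

Lemma subring_set0 : R 0. Proof. by have [h1 hB _] := hR; rewrite -(subrr 1); exact: hB. Qed.
Lemma subring_setN x : R x -> R (- x).
Proof. by have [_ hB _] := hR; rewrite -sub0r; apply: hB; exact: subring_set0. Qed.
Lemma subring_setD x y : R x -> R y -> R (x + y).
Proof. by have [_ hB _] := hR => Rx Ry; rewrite -[y]opprK; apply: hB => //; exact: subring_setN. Qed.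
Lemma subring_set_sum (I : Type) (r : seq I) (P : pred I) (F : I -> T) :
  (forall i, P i -> R (F i)) -> R (\sum_(i <- r | P i) F i).
Proof.
by move=> h; elim/big_ind: _ => //; [exact: subring_set0|exact: subring_setD].
Qed.
Lemma subring_setX x n : R x -> R (x ^+ n).
Proof.
have [h1 _ hM] := hR; move=> Rx; elim: n => // n IH; rewrite exprS; exact: hM.
Qed.

Lemma poly_overB f g : poly_over R f -> poly_over R g -> poly_over R (f - g).
Proof. by have [_ hB _] := hR; move=> hf hg i; rewrite coefB; exact: hB. Qed.
Lemma poly_overM f g : poly_over R f -> poly_over R g -> poly_over R (f * g).
Proof.
by have [_ _ hM] := hR; move=> hf hg i; rewrite coefM; apply: subring_set_sum => j _; exact: hM.
Qed.
Lemma poly_overC x : R x -> poly_over R x%:P.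
Proof. by move=> Rx i; rewrite coefC; case: ifP => // _; exact: subring_set0. Qed.
Lemma poly_overX : poly_over R 'X.
Proof. by have [h1 _ _] := hR; move=> i; rewrite coefX; case: (i == 1%N); [exact: h1|exact: subring_set0]. Qed.
Lemma poly_over1 : poly_over R 1.
Proof. by have [h1 _ _] := hR; apply: poly_overC. Qed.
End SubringSets.

Section SubringOfSet.
Variables (T : comNzRingType) (R : set T).

Definition subring_pred (hR : subring_set R) : {pred T} := fun x => `[< R x >].

Lemma subring_pred_closed hR : subring_closed (subring_pred hR).
Proof.
have [h1 hB hM] := hR; split.
- exact/asboolP.
- by move=> x y /asboolP Rx /asboolP Ry; apply/asboolP; exact: hB.
- by move=> x y /asboolP Rx /asboolP Ry; apply/asboolP; exact: hM.
Qed.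

HB.instance Definition _ hR :=
  GRing.isSubringClosed.Build T (subring_pred hR) (subring_pred_closed hR).

End SubringOfSet.

Section GeneratedSubring.
Variables (T : comNzRingType) (S : set T).

Lemma subring_gen_set : subring_set (subring_gen S).
Proof.
split=> [B _|x y hx hy B SB|x y hx hy B SB]; first exact: rpred1.
- by apply: rpredB; [exact: hx|exact: hy].
- by apply: rpredM; [exact: hx|exact: hy].
Qed.

Lemma sub_subring_gen : S `<=` subring_gen S.
Proof. by move=> x Sx B; exact. Qed.

Lemma subring_gen_min R : subring_set R -> S `<=` R -> subring_gen S `<=` R.
Proof.
move=> hR SR x /(_ (subring_pred hR))h; apply/asboolP; apply: h => y /SR Ry.
exact/asboolP.
Qed.

End GeneratedSubring.

(** * Adjoining generic elements to admissible subrings *)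

Section Admissible.
Variables (T : comNzRingType) (M : set T).
Hypothesis hT : complete_local_ring T.
Hypothesis hM : maximal_ideal M.
Hypothesis Muniq : forall M', maximal_ideal M' -> M' = M.
Variable PP : nat -> set T.
Hypothesis Pprime : forall k, prime_ideal (PP k).
Hypothesis PM : forall k, ~ M `<=` PP k.
Variables (C : nat -> set (set T)) (q : nat -> T) (R0 : set T).
Hypothesis CP : forall i Q, C i Q -> exists k, Q = PP k.
Hypothesis C0 : forall i, C i !=set0.
Hypothesis qC : forall i Q, C i Q -> Q (q i).
Hypothesis q0 : forall i, q i <> 0.
Hypothesis R0q : forall i, R0 (q i).
Hypothesis qreg : forall i x y, (forall Q, C i Q -> ~ Q x) ->
  principal (q i) (x * y) -> principal (q i) y.
Hypothesis zero_divisor_ann : forall x y, x * y = 0 -> y <> 0 ->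
  exists2 z, z <> 0 & x * z = 0 /\ exists k, PP k = [set w | w * z = 0].

Hypothesis PPcase : forall k, (exists i, C i (PP k)) \/ (forall x, PP k x -> ~ regular x).

Implicit Types (x y z t u w : T) (f g : {poly T}) (R J : set T).

Let nT : noetherian T. Proof. by case: hT => [[]]. Qed.
Let MI : is_ideal M. Proof. by case: hM. Qed.
Let MnI n : is_ideal (ideal_exp M n). Proof. exact: ideal_exp_ideal. Qed.
Let PI k : is_ideal (PP k). Proof. by case: (Pprime k). Qed.

(** The field [adm_sat] says that [R] is the intersection of [T] with its quotient field, so
    that [adm_cap] covers all fractions of elements of [R]. *)
Record admissible R : Prop := Admissible {
  adm_sub : subring_set R;
  adm_base : R0 `<=` R;
  adm_sat : forall s x, R s -> s <> 0 -> R (s * x) -> R x;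
  adm_reg : forall x, R x -> x <> 0 -> regular x;
  adm_cap : forall i Q x, C i Q -> R x -> Q x -> principal (q i) x }.

Lemma C_ideal i Q : C i Q -> is_ideal Q. Proof. by move=> /CP[k ->]. Qed.

(** The zero divisors of [T] are covered by the annihilators among the [PP k]. *)
Lemma avoids_regular x : avoids PP x -> regular x.
Proof.
move=> ax y xy; apply: contrapT => y0; have [z z0 [xz [k Pk]]] := zero_divisor_ann xy y0.
by apply: (ax k); rewrite Pk.
Qed.

Lemma q_in_maximal i : M (q i).
Proof.
have [Q CQ] := C0 i; have [k Qk] := CP CQ.
by apply: (prime_sub_maximal hT Muniq Pprime (k := k)); rewrite -Qk; exact: qC.
Qed.

Section Adjoin.
Variables (R : set T) (t : T).
Hypotheses (hR : admissible R) (ht : generic PP R t).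

Let Rsub := adm_sub hR.

(** The intersection of [T] with the quotient field of [R[t]]. *)
Definition adjoin : set T :=
  [set x | exists f g, [/\ poly_over R f, poly_over R g, g <> 0 & g.[t] * x = f.[t]]].

(** A zero divisor lies in some [PP k] that is an annihilator; then so do the coefficients of
    [f], while the nonzero elements of [R] are regular. *)
Lemma generic_regular f : poly_over R f -> f <> 0 -> regular f.[t].
Proof.
move=> Rf f0 y fy; apply: contrapT => y0; have [z z0 [fz [k Pk]]] := zero_divisor_ann fy y0.
apply: f0; apply/polyP => i; rewrite coef0; apply: contrapT => fi0.
apply: z0; apply: (adm_reg hR (Rf i) fi0).
have := ht Rf (k := k); rewrite Pk => h; exact: h fz i.
Qed.

Lemma poly_over_mul0 f g : poly_over R f -> poly_over R g -> f <> 0 -> g <> 0 -> f * g <> 0.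
Proof.
move=> Rf Rg f0 g0 fg0.
have := regularM (generic_regular Rf f0) (generic_regular Rg g0).
by rewrite -hornerM fg0 horner0 => /regular_neq0.
Qed.

Lemma adjoin_poly f : poly_over R f -> adjoin f.[t].
Proof.
move=> Rf; exists f, 1; split=> //; first exact: poly_over1.
  by apply/eqP; exact: oner_neq0.
by rewrite hornerC mul1r.
Qed.

Lemma sub_adjoin : R `<=` adjoin.
Proof. by move=> x Rx; rewrite -(hornerC x t); apply: adjoin_poly; exact: poly_overC. Qed.

Lemma adjoin_in : adjoin t.
Proof. by rewrite -{1}(hornerX t); apply: adjoin_poly; exact: poly_overX. Qed.

(** The largest power of [q i] is factored out of the coefficients; it exists since the
    powers of [M] intersect in [0]. *)
Lemma factor_out i f : poly_over R f -> f <> 0 ->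
  exists k f1, [/\ poly_over R f1, f.[t] = q i ^+ k * f1.[t] &
    forall Q, C i Q -> ~ Q f1.[t]].
Proof.
move=> Rf f0.
have [N fN] : exists N j, ~ principal (q i ^+ N) f`_j.
  apply: contrapT => nN; apply: f0; apply/polyP => j; rewrite coef0.
  apply: (complete_sep hT hM) => n.
  have /(_ _ _)/contrapT : forall N j, ~ ~ principal (q i ^+ N) f`_j.
    by move=> N l h; apply: nN; exists N, l.
  move=> /(_ n j); apply: principal_min => //.
  by apply: ideal_expX; exact: q_in_maximal.
elim: N f Rf {f0} fN => [|N IH] f Rf [j fj].
  by case: fj; exists f`_j; rewrite expr0 mul1r.
have [all|/existsNP[l nl]] := pselect (forall l, principal (q i) f`_l); last first.
  exists 0%N, f; split=> //; first by rewrite expr0 mul1r.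
  move=> Q CQ Qf; apply: nl; apply: (adm_cap hR CQ) => //.
  by have [k Qk] := CP CQ; move: Qf; rewrite Qk => /(ht Rf).
have [c cP] := choice all.
pose f' := \poly_(l < size f) c l.
have ff' : f = q i *: f'.
  apply/polyP => l; rewrite coefZ coef_poly; case: ltnP => h; first exact: cP.
  by rewrite mulr0 nth_default.
have Rf' : poly_over R f'.
  move=> l; apply: (adm_sat hR (s := q i)) => //; first exact/(adm_base hR)/R0q.
  by rewrite -coefZ -ff'.
have [|k [f1 [Rf1 e h]]] := IH f' Rf'.
  exists j => -[d fd]; apply: fj; exists d; rewrite ff' coefZ fd exprS mulrA //.
by exists k.+1, f1; split=> //; rewrite ff' hornerZ e exprS mulrA.
Qed.

(** The condition at [Q] in [C i] is the essential one.  A fraction [f(t) / g(t)] lying in [Q]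
    is [q i ^ (k - l)] times [f1(t) / g1(t)], with [f1(t)] and [g1(t)] outside every element
    of [C i], by [factor_out].  Then [k > l], as [f1(t)] is not in [Q], and division by [g1(t)], which is
    regular modulo [q i], leaves a multiple of [q i]. *)
Lemma adjoin_admissible : admissible adjoin.
Proof.
have qreg' i : regular (q i) by apply: (adm_reg hR) => //; exact/(adm_base hR)/R0q.
split.
- split.
  + by apply: sub_adjoin; case: Rsub.
  + move=> x x' [f [g [Rf Rg g0 e]]] [f' [g' [Rf' Rg' g0' e']]].
    exists (f * g' - f' * g), (g * g'); split.
    * by apply: poly_overB => //; exact: poly_overM.
    * exact: poly_overM.
    * exact: poly_over_mul0.
    * by rewrite hornerD hornerN !hornerM -e -e'; ring.
  + move=> x x' [f [g [Rf Rg g0 e]]] [f' [g' [Rf' Rg' g0' e']]].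
    exists (f * f'), (g * g'); split.
    * exact: poly_overM.
    * exact: poly_overM.
    * exact: poly_over_mul0.
    * by rewrite !hornerM -e -e'; ring.
- by apply: subset_trans sub_adjoin; exact: adm_base.
- move=> s x [f [g [Rf Rg g0 e]]] s0 [f' [g' [Rf' Rg' g0' e']]].
  exists (g * f'), (g' * f); split.
  + exact: poly_overM.
  + exact: poly_overM.
  + apply: poly_over_mul0 => // f0; apply: s0.
    by apply: (generic_regular Rg g0); rewrite e f0 horner0.
  + by rewrite !hornerM -e -e'; ring.
- move=> x [f [g [Rf Rg g0 e]]] x0 y xy.
  have f0 : f <> 0.
    by move=> f0; apply: x0; apply: (generic_regular Rg g0); rewrite e f0 horner0.
  by apply: (generic_regular Rf f0); rewrite -e -mulrA xy mulr0.
- move=> i Q x CQ [f [g [Rf Rg g0 e]]] Qx.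
  have hQ := C_ideal CQ.
  have [f0|f0] := pselect (f = 0).
    rewrite (_ : x = 0); first exact: ideal0 (principal_ideal _).
    by apply: (generic_regular Rg g0); rewrite e f0 horner0.
  have [k [f1 [Rf1 ef hf]]] := factor_out i Rf f0.
  have [l [g1 [Rg1 eg hg]]] := factor_out i Rg g0.
  rewrite ef eg in e.
  have [kl|lk] := leqP k l.
    case: (hf _ CQ); rewrite (_ : f1.[t] = (q i ^+ (l - k) * g1.[t]) * x); first exact: idealMl.
    apply: (regularI (@regularX _ _ k (qreg' i))).
    by rewrite -e -{1}(subnKC kl) exprD; ring.
  apply: (qreg hg); exists (q i ^+ (k - l).-1 * f1.[t]).
  apply: (regularI (@regularX _ _ l (qreg' i))).
  rewrite mulrA e -{1}(subnKC (ltnW lk)) exprD.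
  have [d ->] : exists d, (k - l = d.+1)%N by exists (k - l).-1; rewrite prednK ?subn_gt0.
  by rewrite exprS /=; ring.
Qed.

Lemma adjoin_embeds (D : Type) : infinite_type D -> embeds R D -> embeds adjoin D.
Proof.
move=> Di RD.
have [e eI] : embeds ([set s : seq T | forall x, x \in s -> R x] `*`
                      [set s : seq T | forall x, x \in s -> R x]) D.
  by apply: embeds_prod => //; exact: embeds_seq.
have Rs f : poly_over R f -> forall x, x \in (f : seq T) -> R x.
  by move=> Rf x /(nthP 0)[i _ <-].
have [d _] := Di; apply: (@embeds_rel _ _ _ (d 0%N) (fun x v => exists f g : {poly T},
  [/\ poly_over R f, poly_over R g, g <> 0 & g.[t] * x = f.[t] /\ v = e (f : seq T, g : seq T)])).
  by move=> x [f [g [Rf Rg g0 h]]]; exists (e (f : seq T, g : seq T)), f, g; split.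
move=> x y v _ _ [f [g [Rf Rg g0 [h ->]]]] [f' [g' [Rf' Rg' g0' [h' ee]]]].
have [/poly_inj ff /poly_inj gg] := eI (_, _) (_, _) (conj (Rs _ Rf) (Rs _ Rg)) (conj (Rs _ Rf') (Rs _ Rg')) ee.
by apply: (regularI (generic_regular Rg g0)); rewrite h ff -h' gg.
Qed.

End Adjoin.

(** The last clause says that [R'] is no larger than [R] when [R] is infinite. *)
Definition extension R R' := [/\ R `<=` R', admissible R' &
  forall D : Type, infinite_type D -> embeds R D -> embeds R' D].

Definition small R := exists D : Type, [/\ infinite_type D, embeds R D & ~ embeds [set: T] D].

Lemma extension_refl R : admissible R -> extension R R. Proof. by move=> hR; split. Qed.

Lemma extension_trans R R' R'' : extension R R' -> extension R' R'' -> extension R R''.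
Proof.
move=> [s1 _ e1] [s2 a2 e2]; split=> //; first exact: subset_trans s2.
by move=> D Di RD; apply: e2 => //; exact: e1.
Qed.

Lemma extension_small R R' : extension R R' -> small R -> small R'.
Proof. by move=> [_ _ e] [D [Di RD TD]]; exists D; split=> //; exact: e. Qed.

Lemma extend_generic R u z : admissible R -> small R -> M z -> avoids PP z ->
  exists R' w, [/\ extension R R', R' (u + z * w) & generic PP R (u + z * w)].
Proof.
move=> hR [D [Di RD TD]] Mz az.
have [w hw] := @generic_exists T M hT hM Muniq PP Pprime D R u z Di RD TD Mz az.
exists (adjoin R (u + z * w)), w; split=> //; last exact: adjoin_in.
split; [exact: sub_adjoin|exact: adjoin_admissible|].
by move=> D' Di' RD'; exact: adjoin_embeds.
Qed.

Lemma generic_avoids R t : admissible R -> generic PP R t -> avoids PP t.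
Proof.
move=> hR ht k Pt; have [_ P1 _] := Pprime k; apply: P1.
by have := ht k 'X (poly_overX (adm_sub hR)); rewrite hornerX => /(_ Pt 1%N); rewrite coefX.
Qed.

(** The coset contains [u + z T] for some [z] in [J] to which genericity applies. *)
Lemma extend_coset R J u : admissible R -> small R -> is_ideal J ->
  (forall k, ~ J `<=` PP k) ->
  exists R', extension R R' /\ exists t, [/\ R' t, J (t - u) & avoids PP t].
Proof.
move=> hR sR hJ nJ.
have [z [Jz Mz az]] := countable_prime_avoidance_max hT hM Muniq Pprime PM hJ nJ.
have [R' [w [RR' R't gt]]] := extend_generic u hR sR Mz az.
exists R'; split=> //; exists (u + z * w); split=> //.
  by rewrite addrC addKr; exact: idealMr.
exact: generic_avoids hR gt.
Qed.

(** The generic elements are adjoined one after the other, each over the ring already obtained. *)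
Lemma extend_many R (n : nat) (v : nat -> T) b : admissible R -> small R ->
  M b -> avoids PP b ->
  exists R', extension R R' /\ exists x : nat -> T, forall i, (i < n)%N ->
    R' (x i) /\ principal b (x i - v i).
Proof.
move=> hR sR Mb ab; elim: n => [|n [R1 [RR1 [x xP]]]].
  by exists R; split; [exact: extension_refl|exists (fun=> 0)].
have [_ hR1 _] := RR1.
have [R' [w [RR' R't gt]]] := extend_generic (v n) hR1 (extension_small RR1 sR) Mb ab.
exists R'; split; first exact: extension_trans RR1 RR'.
exists (fun i => if i == n then v n + b * w else x i) => i.
rewrite ltnS leq_eqVlt; case: eqP => [-> _|_ /= lin].
  by split=> //; exists w; rewrite addrC addKr.
by have [? ?] := xP i lin; split=> //; have [s _ _] := RR'; exact: s.
Qed.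

(** For a generic [tau], the element [b = a_0 + a_1 tau + ...] lies in no [PP k].  The
    coefficients [t i] are moved to generic elements [x i] of [t i + b z T], with [z] in the
    maximal ideal and in no [PP k]; the error [c - sum a_i x_i] is then [b y] with [y] in
    [T].  Since [y] is a fraction of elements of the new ring it belongs to it, and [b] is
    itself a combination of the [a i]. *)
Lemma extend_closure_coprime R n (a t : nat -> T) c : admissible R -> small R ->
  (forall i, (i < n)%N -> R (a i)) -> R c -> c = \sum_(i < n) a i * t i ->
  (forall k, exists2 i, (i < n)%N & ~ PP k (a i)) ->
  exists R', extension R R' /\ exists x : nat -> T,
    (forall i, (i < n)%N -> R' (x i)) /\ c = \sum_(i < n) a i * x i.
Proof.
move=> hR sR Ra Rc ct cop.
have [z Mz az] := avoiding_exists hT hM Muniq Pprime PM.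
have [R1 [w [RR1 R1t gt]]] := extend_generic 0 hR sR Mz az.
set tau := 0 + z * w in R1t gt.
pose b := (\poly_(i < n) a i).[tau].
have Rpoly : poly_over R (\poly_(i < n) a i).
  by move=> i; rewrite coef_poly; case: ifP => [/Ra//|_]; exact: subring_set0 (adm_sub hR).
have ab : avoids PP b.
  move=> k /(gt k _ Rpoly) h; have [i lin] := cop k; apply.
  by have := h i; rewrite coef_poly lin.
have abz : avoids PP (b * z).
  by move=> k; have [_ _ hP] := Pprime k; move=> /hP[/ab|/az].
have Mbz : M (b * z) by exact: idealMl.
have [R1s hR1 _] := RR1.
have [R' [RR' [x xP]]] := extend_many n t hR1 (extension_small RR1 sR) Mbz abz.
have [R's hR' _] := RR'; have R'sub := adm_sub hR'; have [R'1 R'B R'M] := R'sub.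
have xt i : exists v, (i < n)%N -> x i = t i + b * z * v.
  case: (ltnP i n) => [lin|_]; last by exists 0.
  by have [_ [v e]] := xP _ lin; exists v => _; rewrite -e addrC subrK.
have [v vP] := choice xt.
have bE : b = \sum_(i < n) a i * tau ^+ i by rewrite /b horner_poly.
have R'b : R' b.
  rewrite bE; apply: (subring_set_sum R'sub) => i _; apply: R'M.
    by apply/R's/R1s/Ra.
  by apply: (subring_setX R'sub); exact: R's.
pose y := - (z * \sum_(i < n) a i * v i).
have cE : c = \sum_(i < n) a i * x i + b * y.
  have -> : \sum_(i < n) a i * x i = c + b * z * \sum_(i < n) a i * v i.
    rewrite ct mulr_sumr -big_split; apply: eq_bigr => i _.
    by rewrite vP //= mulrDr; congr (_ + _); ring.
  by rewrite /y; ring.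
have R'y : R' y.
  apply: (adm_sat hR' R'b); first exact/regular_neq0/avoids_regular.
  rewrite (_ : b * y = c - \sum_(i < n) a i * x i); last by rewrite cE; ring.
  apply: R'B; first exact/R's/R1s.
  apply: (subring_set_sum R'sub) => i _; apply: R'M; last by case: (xP i).
  by apply/R's/R1s/Ra.
exists R'; split; first exact: extension_trans RR1 RR'.
exists (fun i => x i + tau ^+ i * y); split=> [i lin|].
  apply: (subring_setD R'sub); first by case: (xP i lin).
  by apply: R'M => //; apply: (subring_setX R'sub); exact: R's.
by rewrite cE bE mulr_suml -big_split; apply: eq_bigr => i _; rewrite mulrDr mulrA.
Qed.

(** Common factors [d] are divided out so that the quotients [a' i] generate an ideal as large
    as possible.  If some [Q] in [C i] contained all of them, they would be divisible by
    [q i].  By maximality their quotients by [q i] generate no larger ideal; this ideal is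
    therefore [q i] times itself, and vanishes by Nakayama's lemma. *)
Lemma extend_closure R n (a t : nat -> T) c : admissible R -> small R ->
  (forall i, (i < n)%N -> R (a i)) -> R c -> c = \sum_(i < n) a i * t i ->
  exists R', extension R R' /\ exists x : nat -> T,
    (forall i, (i < n)%N -> R' (x i)) /\ c = \sum_(i < n) a i * x i.
Proof.
move=> hR sR Ra Rc ct.
have [az|/existsNP[j0 /not_implyP[j0n aj0]]] := pselect (forall i, (i < n)%N -> a i = 0).
  exists R; split; first exact: extension_refl.
  exists (fun=> 0); split=> [i _|]; first exact: subring_set0 (adm_sub hR).
  by rewrite ct !big1 // => i _; rewrite az // mul0r.
have R1 : R 1 by case: (adm_sub hR).
pose gen (a' : nat -> T) := ideal_gen [set y | exists2 i, (i < n)%N & y = a' i].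
pose div d (a' : nat -> T) := [/\ R d, d <> 0 &
  forall i, (i < n)%N -> R (a' i) /\ a i = d * a' i].
have [||_ [d [a' [[Rd d0 aa'] ->]]] gmax] := @noetherian_max T nT
    [set I | exists d a', div d a' /\ I = gen a'].
- exists (gen a), 1, a; split=> //; split=> // [|i lin]; first exact/eqP/oner_neq0.
  by rewrite mul1r; split=> //; exact: Ra.
- by move=> _ [d [a' [_ ->]]]; exact: ideal_gen_ideal.
have dreg := adm_reg hR Rd d0.
pose c' := \sum_(i < n) a' i * t i.
have cc' : c = d * c'.
  by rewrite ct mulr_sumr; apply: eq_bigr => i _; rewrite mulrA; have [_ <-] := aa' i (ltn_ord i).
have Rc' : R c' by apply: (adm_sat hR Rd d0); rewrite -cc'.
have Ra' i : (i < n)%N -> R (a' i) by move=> /aa'[].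
have [|R' [RR' [x [R'x xE]]]] := extend_closure_coprime hR sR Ra' Rc' (erefl c'); last first.
  exists R'; split=> //; exists x; split=> //.
  rewrite cc' xE mulr_sumr; apply: eq_bigr => i _; rewrite mulrA.
  by have [_ <-] := aa' i (ltn_ord i).
have a'j0 : a' j0 <> 0.
  by move=> e; apply: aj0; have [_ ->] := aa' _ j0n; rewrite e mulr0.
move=> k; have [[i Ci]|Pk] := PPcase k; last first.
  by exists j0 => // /Pk; apply; apply: (adm_reg hR) => //; exact: Ra'.
apply: contrapT => nk.
have qdiv j : exists y, (j < n)%N -> a' j = q i * y.
  have [ljn|_] := ltnP j n; last by exists 0.
  have [y ->] : principal (q i) (a' j); last by exists y.
  apply: (adm_cap hR Ci); first exact: Ra'.
  by apply: contrapT => nP; apply: nk; exists j.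
have [a'' a''P] := choice qdiv.
have Rq : R (q i) by exact/(adm_base hR)/R0q.
have genE : gen a'' = gen a'.
  apply: gmax.
    exists (d * q i), a''; split=> //; split.
    - by have [_ _ h] := adm_sub hR; exact: h.
    - by apply: regular_neq0; apply: regularM => //; exact: (adm_reg hR).
    - move=> j ljn; have [Raj aj] := aa' j ljn; split.
        by apply: (adm_sat hR Rq) => //; rewrite -a''P.
      by rewrite aj a''P // mulrA.
  apply: ideal_gen_min; first exact: ideal_gen_ideal.
  move=> _ [j ljn ->]; rewrite a''P //; apply: (idealMl _ (ideal_gen_ideal _)).
  by apply: sub_ideal_gen; exists j.
have hg := ideal_gen_ideal [set y | exists2 i, (i < n)%N & y = a'' i].
have : gen a'' `<=` [set 0].
  apply: (nakayama nT hM Muniq hg (zero_ideal T)).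
  have hm := ideal_mul_ideal M (gen a'').
  change (gen a'' `<=` ideal_add [set 0] (ideal_mul M (gen a''))).
  rewrite {1}genE; apply: (@subset_trans _ (ideal_mul M (gen a''))); last first.
    by apply: ideal_addr; exact: zero_ideal.
  apply: ideal_gen_min => // _ [j ljn ->]; rewrite a''P //; apply: ideal_mul_in; first exact: q_in_maximal.
  by apply: sub_ideal_gen; exists j.
move=> /(_ (a'' j0))h; apply: a'j0; rewrite a''P //.
by rewrite h ?mulr0 //; apply: sub_ideal_gen; exists j0.
Qed.

Lemma admissible_bigcup (F : set (set T)) : F !=set0 -> total_on F subset ->
  (forall R, F R -> admissible R) -> admissible (\bigcup_(R in F) R).
Proof.
move=> [R FR] Ftot Fadm; pose U := \bigcup_(R in F) R.
have two x y : U x -> U y -> exists2 R, F R & R x /\ R y.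
  move=> [X FX Xx] [Y FY Yy].
  by have [XY|YX] := Ftot _ _ FX FY; [exists Y|exists X] => //; split=> //; auto.
split.
- split.
  + by exists R => //; case: (adm_sub (Fadm _ FR)).
  + by move=> x y Ux Uy; have [X FX [Xx Xy]] := two _ _ Ux Uy; exists X => //;
      case: (adm_sub (Fadm _ FX)) => _ h _; exact: h.
  + by move=> x y Ux Uy; have [X FX [Xx Xy]] := two _ _ Ux Uy; exists X => //;
      case: (adm_sub (Fadm _ FX)) => _ _ h; exact: h.
- by move=> x Rx; exists R => //; exact: (adm_base (Fadm _ FR)).
- move=> s x Us s0 Usx; have [X FX [Xs Xsx]] := two _ _ Us Usx.
  by exists X => //; exact: (adm_sat (Fadm _ FX) Xs).
- by move=> x [X FX Xx]; exact: (adm_reg (Fadm _ FX)).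
- by move=> i Q x CQ [X FX Xx]; exact: (adm_cap (Fadm _ FX) CQ).
Qed.

End Admissible.

(** * The transfinite union *)

Section Transfinite.
Variables (T : comNzRingType) (K : Type) (adm : set T -> Prop).
Variables (R0 : set T) (Done : set T -> set T -> K -> Prop).
Hypothesis Tunc : ~ embeds [set: T] nat.
Hypothesis Tinf : infinite_type T.
Hypothesis KT : embeds [set: K] T.
Hypothesis R0adm : adm R0.
Hypothesis R0count : embeds R0 nat.
Hypothesis adm_union : forall F : set (set T), F !=set0 -> total_on F subset ->
  (forall R, F R -> adm R) -> adm (\bigcup_(R in F) R).
Hypothesis step : forall R k, adm R -> small R -> exists R',
  [/\ R `<=` R', adm R', (forall D : Type, infinite_type D -> embeds R D -> embeds R' D) &
      Done R R' k].

(** A well-ordered chain in which every task [k] is treated at stages that are cofinal in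
    the order.  The stage indexed by [a] is no larger than [nat] plus the initial segment
    below [a], hence is smaller than [T]. *)
Lemma transfinite_union : exists2 A : set T, adm A & forall k (s : seq T),
  (forall x, x \in s -> A x) ->
  exists R R', [/\ forall x, x \in s -> R x, Done R R' k & R' `<=` A].
Proof.
have [lt [ltwf lttr lttot ltsmall]] := initial_well_order T.
have /choice[G GP] : forall Rk : set T * K, exists R', adm Rk.1 -> small Rk.1 ->
  [/\ Rk.1 `<=` R', adm R', (forall D : Type, infinite_type D -> embeds Rk.1 D -> embeds R' D) &
      Done Rk.1 R' Rk.2].
  move=> [R k] /=; have [[hR sR]|n] := pselect (adm R /\ small R).
    by have [R' h] := step k hR sR; exists R'.
  by exists R => hR sR; case: n.
(* [tau] takes every value on a set as large as [T], hence cofinally *)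
have [e eI] : embeds [set: T * K] T.
  by rewrite -setXTT; apply: embeds_prod => //; exists id.
have [k0|nk] := pselect (inhabited K); last first.
  by exists R0 => // k; case: nk; constructor.
case: k0 => k0.
have /choice[tau tauP] : forall a, exists k, forall s k', e (s, k') = a -> k = k'.
  move=> a; have [[[s k] ek]|n] := pselect (exists u, e u = a).
    by exists k => s' k' e'; have [] := eI (s, k) (s', k') I I (etrans ek (esym e')).
  by exists k0 => s k' e'; case: n; exists (s, k').
pose F := Fix ltwf (fun _ => set T) (fun a rec =>
  R0 `|` [set x | exists b (h : lt b a), G (rec b h, tau b) x]).
have FE a : F a = R0 `|` [set x | exists2 b, lt b a & G (F b, tau b) x].
  rewrite /F Fix_eq.
    by congr (_ `|` _); apply/seteqP; split=> x; [case=> b [h hx]; exists b|case=> b h hx; exists b, h].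
  move=> b f g fg; congr (_ `|` _); apply/seteqP; split=> x [c [h hx]]; exists c, h.
    by rewrite -fg.
  by rewrite fg.
pose S b := G (F b, tau b).
have FS b a : lt b a -> S b `<=` F a by move=> ba x Sx; rewrite FE; right; exists b.
(* the bound on the size of the stage [F a] *)
pose D a : Type := (nat + {b | lt b a})%type.
have Dinf a : infinite_type (D a) by exists inl => x y _ _ [].
have DT a : ~ embeds [set: T] (D a).
  have [fin|inf] := pselect (finite_set [set b | lt b a]).
    move=> [f fI]; have /countable_injP[h hI] := finite_set_countable fin.
    apply: Tunc; apply: (@embeds_trans _ _ (nat + nat)%type); last first.
      by exists pickle => x y _ _ /(pcan_inj pickleK).
    exists (fun x => match f x with inl n => inl n | inr b => inr (h (sval b)) end).
    move=> x y _ _; move: (fI x y I I).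
    case: (f x) (f y) => [n|[b hb]] [n'|[b' hb']] //= fxy; first by move=> [?]; apply: fxy; congr inl.
    move=> [hh]; apply: fxy; congr inr; apply: eq_exist => //.
    by apply: hI hh; rewrite inE.
  move=> TD; apply: (ltsmall a).
  have [h hI] : infinite_type {b | lt b a}.
    have /infiniteP/card_leP[f] := inf.
    exists (fun n : nat => exist _ (val (f (SigSub (mem_set I : n \in [set: nat]))))
      (set_mem (valP (f (SigSub (mem_set I : n \in [set: nat])))))) => m n _ _ emn.
    by have [] := inj (mem_set I) (mem_set I) (val_inj (congr1 sval emn)).
  apply: (embeds_trans TD).
  have [g gI] : embeds ([set: bool] `*` [set: {b | lt b a}]) {b | lt b a}.
    have seginf : infinite_type {b | lt b a} by exists h.
    apply: embeds_prod => //; last by exists id.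
    apply: (@embeds_trans _ _ nat); last by exists h.
    by exists pickle => x y _ _ /(pcan_inj pickleK).
  exists (fun v : D a => match v with inl n => g (true, h n) | inr c => g (false, c) end).
  by move=> [n|c] [n'|c'] _ _ ee; have [] := gI (_, _) (_, _) (conj I I) (conj I I) ee => //;
    [move=> /(hI _ _ I I) ->|move=> ->].
have small_of a : embeds (F a) (D a) -> small (F a) by exists (D a).
have main a : adm (F a) /\ embeds (F a) (D a).
  elim/(well_founded_ind ltwf): a => a IH.
  have SP b : lt b a -> [/\ F b `<=` S b, adm (S b),
      (forall D : Type, infinite_type D -> embeds (F b) D -> embeds (S b) D) &
      Done (F b) (S b) (tau b)].
    by move=> /IH[aF eF]; apply: (GP (F b, tau b)) => //; exact: small_of.
  split.
    rewrite (_ : F a = \bigcup_(R in [set R | R = R0 \/ exists2 b, lt b a & R = S b]) R).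
      apply: adm_union.
      - by exists R0; left.
      - move=> R R' [->|[b ba ->]] [->|[b' ba' ->]].
        + by left.
        + by left => x R0x; have [+ _ _ _] := SP _ ba'; apply; rewrite FE; left.
        + by right => x R0x; have [+ _ _ _] := SP _ ba; apply; rewrite FE; left.
        + have [bb|->|bb] := lttot b b'; [left|by left|right] => x /(FS _ _ bb).
            by have [+ _ _ _] := SP _ ba'; exact.
          by have [+ _ _ _] := SP _ ba; exact.
      - by move=> R [->//|[b /SP[_ + _ _] ->]].
    rewrite {1}FE; apply/seteqP; split=> x.
      by move=> [R0x|[b ba Sx]]; [exists R0 => //; left|exists (S b) => //; right; exists b].
    by move=> [R [->|[b ba ->]] Rx]; [left|right; exists b].
  have SD b : lt b a -> embeds (S b) (D a).
    move=> ba; have [_ _ + _] := SP b ba; apply => //.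
    apply: embeds_trans (IH b ba).2 _.
    exists (fun v : D b => match v with inl n => inl n
      | inr c => inr (exist (fun x => lt x a) (sval c) (lttr _ _ _ (svalP c) ba)) end).
    move=> [n|[c hc]] [n'|[c' hc']] _ _ //= [] ; first by move=> ->.
    by move=> cc; congr inr; apply: eq_exist.
  have [r0 r0I] := R0count.
  have /choice[g gP] : forall b, exists g : T -> D a, lt b a ->
      forall x y, S b x -> S b y -> g x = g y -> x = y.
    move=> b; have [/SD[g gI]|nb] := pselect (lt b a); first by exists g.
    by exists (fun=> inl 0%N).
  apply: (@embeds_trans _ _ (D a * D a)%type); last exact: square_embeds.
  apply: (@embeds_rel _ _ _ (inl 0%N, inl 0%N) (fun x v =>
    (R0 x /\ v = (inl 0%N, inl (r0 x))) \/
    exists b (h : lt b a), S b x /\ v = (inr (exist (fun c => lt c a) b h), g b x))).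
    move=> x; rewrite FE => -[R0x|[b ba Sx]].
      by exists (inl 0%N, inl (r0 x)); left.
    by exists (inr (exist (fun c => lt c a) b ba), g b x); right; exists b, ba.
  move=> x y v _ _ [[Rx ->]|[b [h [Sx ->]]]] [[Ry]|[b' [h' [Sy]]]] //.
    by move=> [] /(r0I _ _ Rx Ry).
  by move=> [bb]; rewrite -bb in Sy *; exact: gP.
have SP b : [/\ F b `<=` S b, adm (S b),
      (forall D : Type, infinite_type D -> embeds (F b) D -> embeds (S b) D) &
      Done (F b) (S b) (tau b)].
  by have [aF eF] := main b; apply: (GP (F b, tau b)) => //; exact: small_of.
pose A := \bigcup_b S b.
have Sle b b' : lt b b' -> S b `<=` S b'.
  by move=> bb x /(FS _ _ bb); have [+ _ _ _] := SP b'; exact.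
exists A.
  rewrite (_ : A = \bigcup_(R in range S) R); last by rewrite bigcup_image.
  apply: adm_union.
  - by exists (S (0 : T)); exists 0.
  - move=> _ _ [b _ <-] [b' _ <-].
    by have [/Sle|->|/Sle] := lttot b b'; [left|left|right].
  - by move=> _ [b _ <-]; case: (SP b).
move=> k s sA.
have [b sb] : exists b, forall x, x \in s -> S b x.
  elim: s sA => [|x s IH] sA; first by exists 0.
  have [b sb] : exists b, forall x, x \in s -> S b x.
    by apply: IH => y ys; apply: sA; rewrite inE ys orbT.
  have [b' _ Sx] : A x by apply: sA; rewrite mem_head.
  have [bb|bb|bb] := lttot b b'.
  - by exists b' => y; rewrite inE => /orP[/eqP->//|/sb]; exact: Sle bb _.
  - by exists b' => y; rewrite inE => /orP[/eqP->//|/sb]; rewrite bb.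
  - by exists b => y; rewrite inE => /orP[/eqP->|/sb//]; exact: Sle bb _ Sx.
have [a ba ta] : exists2 a, lt b a & tau a = k.
  apply: contrapT => na; apply: (DT b).
  have le s' : e (s', k) = b \/ lt (e (s', k)) b.
    have [h|->|h] := lttot (e (s', k)) b; [by right|by left|].
    by case: na; exists (e (s', k)) => //; exact: tauP.
  apply: (@embeds_rel _ _ _ (inl 0%N) (fun s' (v : D b) => match v with
    inl _ => e (s', k) = b | inr c => e (s', k) = sval c end)).
    move=> s' _; have [es|h] := le s'; first by exists (inl 0%N).
    by exists (inr (exist (fun c => lt c b) _ h)).
  by move=> x y [n|c] _ _ /= ex ey; have [] := eI (x, k) (y, k) I I (etrans ex (esym ey)).
exists (F a), (S a); split.
- by move=> x /sb; exact: FS.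
- by case: (SP a); rewrite ta.
- by move=> x Sx; exists a.
Qed.
End Transfinite.

(** * Sufficiency of the conditions *)

(** The labels [0] and [1] stand for difference and product; all trees of another shape
    evaluate to [1], which puts [1] in the range. *)
Fixpoint ring_eval (T : comNzRingType) (q : nat -> T) (e : GenTree.tree nat) : T :=
  match e with
  | GenTree.Leaf n => q n
  | GenTree.Node 0 [:: a; b] => ring_eval q a - ring_eval q b
  | GenTree.Node 1 [:: a; b] => ring_eval q a * ring_eval q b
  | _ => 1
  end.

(** The values of the ring expressions in the [q i] form a subring. *)
Lemma countable_subring_gen (T : comNzRingType) (q : nat -> T) :
  embeds (subring_gen (prime_subring T `|` range q)) nat.
Proof.
have hR : subring_set (range (ring_eval q)).
  split; first by exists (GenTree.Node 2 [::]).
  - by move=> _ _ [a _ <-] [b _ <-]; exists (GenTree.Node 0 [:: a; b]).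
  - by move=> _ _ [a _ <-] [b _ <-]; exists (GenTree.Node 1 [:: a; b]).
apply: (@embeds_sub _ _ (range (ring_eval q))).
  apply: subring_gen_min => // x [[z ->]|[i _ <-]]; last by exists (GenTree.Leaf i).
  by apply/(asboolP (range (ring_eval q) z%:~R)); exact: (rpred_int (subring_pred hR) z).
apply: (@embeds_rel _ _ _ 0%N (fun x n => exists2 e, ring_eval q e = x & pickle e = n)).
  by move=> _ [e _ <-]; exists (pickle e), e.
by move=> x y n _ _ [e <- <-] [e' <- /(pcan_inj pickleK) ->].
Qed.

Lemma countable_enum (U : Type) (A : set U) : A !=set0 -> countable A ->
  exists f : nat -> U, range f = A.
Proof.
move=> [a Aa] /countable_injP[g gI].
have /choice[f fP] : forall n, exists x, A x /\ forall y, A y -> g y = n -> y = x.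
  move=> n; have [[x [Ax gx]]|nx] := pselect (exists x, A x /\ g x = n).
    by exists x; split=> // y Ay gy; apply: gI; rewrite ?inE // gx.
  by exists a; split=> // y Ay gy; case: nx; exists y.
exists f; apply/seteqP; split=> [_ [n _ <-]|x Ax]; first by case: (fP n).
by exists (g x) => //; have [_ /(_ x Ax erefl)] := fP (g x).
Qed.

Section Sufficiency.
Variables (T : comNzRingType) (hT : complete_local_ring T).
Variable C : nat -> set (set T).
Hypothesis hC0 : forall i, C i !=set0.
Hypothesis hCcount : forall i, countable (C i).
Hypothesis hCprime : forall i Q, C i Q -> prime_ideal Q /\ ~ maximal_ideal Q.
Hypothesis hCinc : forall i Q Q', C i Q -> C i Q' -> Q `<=` Q' -> Q = Q'.
Variable q : nat -> T.
Let Piq := subring_gen (prime_subring T `|` range q).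
Hypothesis q0 : forall i, q i <> 0.
Hypothesis qC : forall i, (\bigcap_(Q in C i) Q) (q i) /\
  (forall j Q', C j <> C i -> C j Q' -> ~ Q' (q i)).
Hypothesis qAss : forall P, Ass [set 0] P -> P `&` Piq = [set 0].
Hypothesis qAssq : forall i P', Ass (principal (q i)) P' -> exists2 Q, C i Q & P' `<=` Q.
Hypothesis qcap : forall i Q, C i Q -> quotient_field_cap Piq Q `<=` principal (q i).

Let nT : noetherian T. Proof. by case: hT => [[]]. Qed.
Let Piq_sub : subring_set Piq. Proof. exact: subring_gen_set. Qed.
Let Piq_q i : Piq (q i). Proof. by apply: sub_subring_gen; right; exists i. Qed.
Let qQ i Q : C i Q -> Q (q i). Proof. by move=> CQ; have [h _] := qC i; exact: h. Qed.

(** A zero divisor lies in an associated prime of [T], which meets [Pi[q]] in [0]. *)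
Lemma Piq_regular x : Piq x -> x <> 0 -> regular x.
Proof.
move=> Px x0 y xy; apply: contrapT => y0; apply: x0.
have [P AP APx] := @associated_prime_exists T nT [set 0] x y (zero_ideal T) xy y0.
suff : (P `&` Piq) x by rewrite (qAss AP).
by [].
Qed.

(** The intersection of [T] with the quotient field of [Pi[q]]. *)
Definition saturation : set T := [set x | exists r s, [/\ Piq r, Piq s, s <> 0 & s * x = r]].

Lemma sub_saturation : Piq `<=` saturation.
Proof.
move=> x Px; exists x, 1; split=> //; last by rewrite mul1r.
  by have [] := Piq_sub.
exact/eqP/oner_neq0.
Qed.

Lemma saturation_admissible : admissible C q saturation saturation.
Proof.
have [P1 PB PM] := Piq_sub.
have PMn0 s s' : Piq s -> Piq s' -> s <> 0 -> s' <> 0 -> s * s' <> 0.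
  move=> Ps Ps' s0 s0'; apply: regular_neq0.
  by apply: regularM; exact: Piq_regular.
split=> //.
- split; first exact: sub_saturation.
  + move=> x y [r [s [Pr Ps s0 e]]] [r' [s' [Pr' Ps' s0' e']]].
    exists (r * s' - r' * s), (s * s'); split; last by rewrite -e -e'; ring.
    * by apply: PB; exact: PM.
    * exact: PM.
    * exact: PMn0.
  + move=> x y [r [s [Pr Ps s0 e]]] [r' [s' [Pr' Ps' s0' e']]].
    exists (r * r'), (s * s'); split; last by rewrite -e -e'; ring.
    * exact: PM.
    * exact: PM.
    * exact: PMn0.
- move=> u x [r [s [Pr Ps s0 e]]] u0 [r' [s' [Pr' Ps' s0' e']]].
  exists (s * r'), (s' * r); split; last by rewrite -e -e'; ring.
  + exact: PM.
  + exact: PM.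
  + apply: PMn0 => // r0; apply: u0; apply: (Piq_regular Ps s0).
    by rewrite e r0.
- move=> x [r [s [Pr Ps s0 e]]] x0 y xy.
  have r0 : r <> 0 by move=> r0; apply: x0; apply: (Piq_regular Ps s0); rewrite e r0.
  by apply: (Piq_regular Pr r0); rewrite -e -mulrA xy mulr0.
- by move=> i Q x CQ Rx Qx; apply: (qcap CQ).
Qed.

Lemma saturation_countable : embeds saturation nat.
Proof.
have nati : infinite_type nat by exists id.
have [g gI] := embeds_prod nati (countable_subring_gen q) (countable_subring_gen q).
apply: (@embeds_rel _ _ _ 0%N (fun x n => exists r s,
    [/\ Piq r, Piq s, s <> 0 & s * x = r /\ n = g (r, s)])).
  by move=> x [r [s [Pr Ps s0 e]]]; exists (g (r, s)), r, s; split.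
move=> x y n _ _ [r [s [Pr Ps s0 [e ->]]]] [r' [s' [Pr' Ps' s0' [e' eg]]]].
have [er es] := gI (_, _) (_, _) (conj Pr Ps) (conj Pr' Ps') eg.
by apply: (regularI (Piq_regular Ps s0)); rewrite e er -e' es.
Qed.

(** The enumeration consists of the primes in the [C i] and the annihilators provided by
    [zero_divisor_primes].  The latter differ from the maximal ideal because they do not
    contain [q 0]. *)
Lemma avoided_primes : exists PP : nat -> set T,
  [/\ forall k, prime_ideal (PP k),
      forall M, maximal_ideal M -> (forall M', maximal_ideal M' -> M' = M) ->
        forall k, ~ M `<=` PP k,
      forall i Q, C i Q -> exists k, Q = PP k,
      forall x y, x * y = 0 -> y <> 0 ->
        exists2 z, z <> 0 & x * z = 0 /\ exists k, PP k = [set w | w * z = 0] &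
      forall k, (exists i, C i (PP k)) \/ (forall x, PP k x -> ~ regular x)].
Proof.
have [s [s1 s2]] := zero_divisor_primes nT.
pose B := (\bigcup_i C i) `|` (colon [set 0] @` [set` s]).
have B0 : B !=set0 by have [Q CQ] := hC0 0; exists Q; left; exists 0%N.
have Bc : countable B.
  rewrite (_ : B = \bigcup_(b in [set: bool]) if b then \bigcup_i C i else colon [set 0] @` [set` s]).
    apply: bigcup_countable => // -[] _.
      by apply: bigcup_countable.
    exact/finite_set_countable/finite_image/finite_seq.
  by apply/seteqP; split=> [Q [h|h]|Q [[] _ h]]; [exists true|exists false|left|right].
have [PP PPB] := countable_enum B0 Bc.
have PPin k : B (PP k) by rewrite -PPB; exists k.
have PPex Q : B Q -> exists k, PP k = Q by rewrite -PPB => -[k _ <-]; exists k.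
exists PP; split.
- move=> k; case: (PPin k) => [[i _ /hCprime[]//]|[z /s1[_ + <-]]//].
- move=> M hM Muniq k; case: (PPin k) => [[i _ /hCprime[[hI P1 PM] nmax]] MP|[z /s1[z0 hz] e]].
    by apply: nmax; rewrite (_ : PP k = M) //; apply/seteqP; split=> //;
       exact: (sub_maximal nT Muniq).
  rewrite -e => /(_ (q 0%N)) h; have [Q CQ] := hC0 0; have [[hI Q1 _] _] := hCprime CQ.
  apply: z0; apply: (Piq_regular (Piq_q 0)) => //.
  by apply: h; apply: (sub_maximal nT Muniq hI Q1); exact: qQ.
- by move=> i Q CQ; have [|k <-] := PPex Q; [left; exists i|exists k].
- move=> x y xy y0; have [z zs xz] := s2 x y xy y0.
  exists z; first by have [] := s1 z zs.
  by split=> //; have [|k e] := PPex (colon [set 0] z); [right; exists z|exists k].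
- move=> k; case: (PPin k) => [[i _ CP]|[z /s1[z0 _] <-]]; [by left; exists i|right].
  by move=> x xz /(_ z xz).
Qed.

(** Otherwise [x] would lie in an associated prime of [T / q i T], hence in some [Q] in [C i]. *)
Lemma regular_mod_q i x y : (forall Q, C i Q -> ~ Q x) ->
  principal (q i) (x * y) -> principal (q i) y.
Proof.
move=> nx xy; apply: contrapT => ny.
have [P /qAssq[Q CQ PQ] Px] := associated_prime_exists nT (principal_ideal (q i)) xy ny.
exact: (nx Q CQ (PQ x Px)).
Qed.

Lemma sufficiency : exists A : subringClosed T,
  [/\ local_domain A, completion_iso A &
      forall i, exists p : subring_of A, prime_element p /\
        C i = maximal_elements (formal_fiber (principal p))].
Proof.
have [_ [M hM Muniq]] := local_ringP hT.1.
have [PP [Pprime /(_ M hM Muniq) PM CP zero_divisor_ann PPcase]] := avoided_primes.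
have [MI M1 _] := hM.
have R0adm := saturation_admissible.
have R0q i : saturation (q i) by exact/sub_saturation/Piq_q.
have Tunc := uncountable hT hM Muniq Pprime PM.
have Tinf : infinite_type T.
  have [z Mz az] := avoiding_exists hT hM Muniq Pprime PM.
  have zreg := avoids_regular zero_divisor_ann az.
  have lt_pow m n : (m < n)%N -> z ^+ m <> z ^+ n.
    move=> mn e; apply: M1; rewrite (_ : 1 = z ^+ (n - m).-1 * z); first exact: idealMl.
    apply: (regularI (@regularX _ _ m zreg)).
    by rewrite mulr1 -exprSr prednK ?subn_gt0 // -exprD subnKC // ltnW.
  exists (fun n => z ^+ n) => m n _ _ e.
  by have [/lt_pow|/lt_pow|//] := ltngtP m n; rewrite e.
pose ideal_of (s : seq T) := ideal_gen [set` s].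
(* [true] marks the task of meeting a coset of an ideal, [false] that of solving a linear
   equation; in both, [s] lists the generators of the ideal *)
pose Done (R R' : set T) (k : bool * (T * seq T)) :=
  let: (b, (u, s)) := k in
  if b then (forall k, ~ ideal_of s `<=` PP k) ->
      exists t, [/\ R' t, ideal_of s (t - u) & avoids PP t]
  else R u -> (forall x, x \in s -> R x) -> ideal_of s u ->
      exists c : nat -> T, (forall i, (i < size s)%N -> R' (c i)) /\
        u = \sum_(i < size s) c i * s`_i.
have KT : embeds [set: bool * (T * seq T)] T.
  rewrite -!setXTT; apply: embeds_prod => //.
    apply: (@embeds_trans _ _ nat) => //.
    by exists nat_of_bool => -[] [] _ _.
  apply: embeds_prod => //; first by exists id.
  apply: (@embeds_sub _ _ [set s : seq T | forall x, x \in s -> [set: T] x]); first by move=> s _ x _.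
  by apply: embeds_seq => //; exists id.
have step R k : admissible C q saturation R -> small R -> exists R',
    [/\ R `<=` R', admissible C q saturation R',
      (forall D : Type, infinite_type D -> embeds R D -> embeds R' D) & Done R R' k].
  case: k => [[] [u s]] hR sR /=.
    have [nJ|nJ] := pselect (forall k, ~ ideal_of s `<=` PP k); last by exists R; split.
    have [R' [[RR' hR' eR'] [t tP]]] := @extend_coset T M hT hM Muniq PP Pprime PM C q
      saturation CP hC0 qQ q0 R0q regular_mod_q zero_divisor_ann R (ideal_of s) u hR sR (ideal_gen_ideal _) nJ.
    by exists R'; split=> // _; exists t.
  have [[Ru [Rs us]]|nh] := pselect (R u /\ (forall x, x \in s -> R x) /\ ideal_of s u); last first.
    by exists R; split=> // Ru Rs us; case: nh.
  have [t tE] := (ideal_gen_seqP s u).1 us.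
  have [||R' [[RR' hR' eR'] [x [R'x xE]]]] := @extend_closure T M hT hM Muniq PP Pprime PM C q
    saturation CP hC0 qQ q0 R0q regular_mod_q zero_divisor_ann PPcase R (size s) (nth 0 s) t u hR sR _ Ru.
  - by move=> i lis; apply: Rs; exact: mem_nth.
  - by rewrite tE; apply: eq_bigr => i _; rewrite mulrC.
  exists R'; split=> // _ _ _; exists x; split=> //.
  by rewrite xE; apply: eq_bigr => i _; rewrite mulrC.
have [R hR RP] := transfinite_union Tunc Tinf KT R0adm saturation_countable
  (@admissible_bigcup T C q saturation) step.
pose A : subringClosed T := subring_pred (adm_sub hR).
have inA x : R x -> exists a : subring_of A, val a = x.
  by move=> Rx; have xA : x \in A := introT (asboolP _) Rx; exists (exist _ x xA).
have valR (a : subring_of A) : R (val a) by apply/asboolP; exact: (svalP a).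
have coset J u : is_ideal J -> (forall k, ~ J `<=` PP k) ->
    exists a : subring_of A, J (val a - u) /\ avoids PP (val a).
  move=> hJ nJ; have [s sJ] := nT hJ.
  have [//|R1 [R2 [_ D R2R]]] := RP (true, (u, s)) [::].
  have [|t [R2t Jt at_]] := D; first by rewrite /ideal_of -sJ.
  have [a ta] := inA t (R2R _ R2t).
  by exists a; rewrite ta sJ.
(* cosets of [M ^ 2], which is contained in no [PP k] *)
have dense2 u : exists a : subring_of A, ideal_exp M 2 (u - val a).
  have [k|a [ha _]] := coset (ideal_exp M 2) u (ideal_exp_ideal M 2).
    by move=> /(prime_exp (Pprime k)); exact: PM.
  by exists a; rewrite -opprB; apply: (idealN (ideal_exp_ideal M 2)).
have closed_fg (x : subring_of A) (s : seq (subring_of A)) :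
    ideal_gen [set` [seq val y | y <- s]] (val x) -> ideal_gen [set` s] x.
  move=> hx; have [|R1 [R2 [R1s D R2R]]] :=
      RP (false, (val x, [seq val y | y <- s])) (val x :: [seq val y | y <- s]).
    move=> y; rewrite inE => /orP[/eqP->|/mapP[z _ ->]]; exact: valR.
  have [|y ys||c [R2c e]] := D.
  - by apply: R1s; exact: mem_head.
  - by apply: R1s; rewrite inE ys orbT.
  - exact: hx.
  rewrite size_map in R2c e.
  have /choice[d dP] : forall i, exists y : subring_of A, (i < size s)%N -> val y = c i.
    move=> i; have [lis|_] := ltnP i (size s); last by exists 0.
    by have [y <-] := inA _ (R2R _ (R2c i lis)); exists y.
  apply/ideal_gen_seqP; exists d; apply: val_inj; rewrite e rmorph_sum.
  apply: eq_bigr => i _; rewrite rmorphM (nth_map 0) //; congr (_ * _).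
  by apply: esym; exact: dP.
have lA : local_ring (subring_of A) by exact: (local_ring_closed hT hM Muniq).
have isoA : completion_iso A by exact: (completion_iso_closed hT hM Muniq).
exists A; split=> //.
  split=> // x y xy; apply/orP; have [x0|x0] := pselect (x = 0).
    by left; apply/eqP.
  right; apply/eqP/val_inj; rewrite rmorph0.
  apply: (adm_reg hR (valR x)).
    by move=> e; apply: x0; apply: val_inj; rewrite e rmorph0.
  by rewrite -rmorphM xy rmorph0.
move=> i; have [p pq] := inA (q i) (adm_base hR (R0q i)).
have prinE (x : subring_of A) : principal (q i) (val x) <-> principal p x.
  have ext := extend_principal p; rewrite pq in ext.
  rewrite -ext; split; last exact: extend_in.
  exact: extend_contract_closed (principal_ideal p).
have QE Q (x : subring_of A) : C i Q -> Q (val x) <-> principal p x.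
  move=> CQ; have [[hI _ _] _] := hCprime CQ; rewrite -prinE; split.
    by move=> Qx; exact: (adm_cap hR CQ (valR x) Qx).
  by apply: (principal_min hI); exact: qQ.
have fibC Q : C i Q -> formal_fiber (principal p) Q.
  move=> CQ; split; first by have [] := hCprime CQ.
  by apply/seteqP; split=> x; have [h1 h2] := QE Q x CQ.
have [Q0 CQ0] := hC0 i; have [[hQ0 Q01 Q0M] _] := hCprime CQ0.
exists p; split.
  split.
  - by move=> p0; apply: (q0 (i := i)); rewrite -pq p0 rmorph0.
  - by move=> /(QE Q0 _ CQ0); rewrite rmorph1.
  - move=> x y /(QE Q0 _ CQ0); rewrite rmorphM => /Q0M[|] h; [left|right]; exact/(QE Q0 _ CQ0).
have below Q' : formal_fiber (principal p) Q' -> exists2 Q, C i Q & Q' `<=` Q.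
  move=> [hQ' e]; have [hI' _ _] := hQ'.
  have Q'E (x : subring_of A) : Q' (val x) = principal p x by rewrite -e.
  have Q'q : Q' (q i) by rewrite -pq Q'E; exact: principal_id.
  apply: contrapT => nQ.
  have nJ k : ~ Q' `<=` PP k.
    move=> Q'P; case: (PPcase k) => [[j CP']|zd].
      have [Cji|nC] := pselect (C j = C i).
        by apply: nQ; exists (PP k) => //; rewrite -Cji.
      by have [_ h] := qC i; apply: (h j (PP k) nC CP'); exact: Q'P.
    apply: (zd (q i) (Q'P _ Q'q)); exact: (Piq_regular (Piq_q i)).
  have [x [hx ax]] := coset Q' 0 hI' nJ.
  rewrite subr0 Q'E -(QE Q0 _ CQ0) in hx.
  by have [k Qk] := CP i Q0 CQ0; apply: (ax k); rewrite -Qk.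
apply/seteqP; split=> Q.
  move=> CQ; split; first exact: fibC.
  move=> Q' /below[Q'' CQ'' Q'Q''] QQ'; apply/seteqP; split=> //.
  have -> // : Q = Q''; apply: (hCinc CQ CQ''); exact: subset_trans Q'Q''.
move=> [/below[Q' CQ' QQ'] Qmax].
by rewrite -(Qmax Q' (fibC _ CQ') QQ').
Qed.
End Sufficiency.

Theorem theorem2p22 (T : comNzRingType) (hT : complete_local_ring T)
    (C : nat -> set (set T))
    (hC0 : forall i, C i !=set0)
    (hCcount : forall i, countable (C i))
    (hCprime : forall i Q, C i Q -> prime_ideal Q /\ ~ maximal_ideal Q)
    (hCinc : forall i Q Q', C i Q -> C i Q' -> Q `<=` Q' -> Q = Q')
    (hCC : forall i j, i <> j ->
       C i = C j \/ (forall Q Q', C i Q -> C j Q' -> ~ (Q `<=` Q'))) :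
  (exists A : subringClosed T,
     [/\ local_domain A, completion_iso A &
         forall i, exists p : subring_of A,
           prime_element p /\
           C i = maximal_elements (formal_fiber (principal p))])
  <->
  (exists q : nat -> T,
     let Piq := subring_gen (prime_subring T `|` range q) in
     [/\ forall i, q i <> 0,
         forall i, (\bigcap_(Q in C i) Q) (q i) /\
           (forall j Q', C j <> C i -> C j Q' -> ~ Q' (q i)),
         forall P, Ass [set 0] P -> P `&` Piq = [set 0],
         forall i P', Ass (principal (q i)) P' ->
           exists2 Q, C i Q & P' `<=` Q &
         forall i Q, C i Q -> quotient_field_cap Piq Q `<=` principal (q i)]).
Proof.
split=> [[A [hA hiso /choice[p pP]]]|[q [q0 qC qAss qAssq qcap]]].
  exists (fun i => val (p i)).
  by apply: (necessity hT hA hiso) => i; have [] := pP i.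
exact: sufficiency qAssq qcap.
Qed.
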